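(* Let $U=[0,1]^2$ be the unit square. If $\Gamma$ is a (rectifiable) interior barrier for $U$, that is, a barrier for $U$ with $\Gamma\subseteq U$, then the length of $\Gamma$ is at least $2+10^{-5}$.
   Context: A set $\Gamma\subset\mathbb{R}^2$ is a barrier (opaque set) for a convex body $C$ in the plane if $\Gamma$ meets every line that intersects $C$. A barrier need not be connected. A barrier is called interior if it is constrained to the interior and the boundary of $C$. Barriers are assumed rectifiable: $\Gamma$ is a countable (finite or infinite) union $\Gamma=\bigcup_i\gamma_i$ of rectifiable curves (curves of finite length) with $\sum_i|\gamma_i|<\infty$, where $|\gamma_i|$ is the length of $\gamma_i$; the length of $\Gamma$ is the total length $\sum_i|\gamma_i|$ of its curves. *)

(* Defs.v *)
From HB Require Import structures.
From mathcomp Require Import all_boot all_order all_algebra.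
From mathcomp Require Import all_classical all_reals all_analysis.
Set Implicit Arguments.
Unset Strict Implicit.
Unset Printing Implicit Defensive.
Import Order.TTheory GRing.Theory Num.Theory.
Import numFieldNormedType.Exports.
Local Open Scope classical_set_scope.
Local Open Scope ring_scope.

(* The library norm on [R * R] is the max norm, which induces the right
   topology but not the Euclidean length. *)
Definition eucl_dist (R : realType) (p q : R * R) : R :=
  Num.sqrt ((p.1 - q.1) ^+ 2 + (p.2 - q.2) ^+ 2).

(* Length of the polygonal line through g a, g s_0, g s_1, ...; the analogue
   of [variation] for maps into the Euclidean plane. *)
Definition polygon_length (R : realType) (a b : R) (g : R -> R * R)
    (s : seq R) : R :=
  let F := g \o nth b (a :: s) in
  \sum_(0 <= n < size s) eucl_dist (F n.+1) (F n).

Definition curve_length (R : realType) (g : R -> R * R) : \bar R :=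
  ereal_sup [set (polygon_length 0 1 g s)%:E | s in itv_partition 0 1].

(* Curves are parametrized by [0, 1]; the values of [g] elsewhere are
   irrelevant. They need not be simple, and may be constant. *)
Definition rectifiable_curve (R : realType) (g : R -> R * R) : Prop :=
  {within `[0, 1], continuous g} /\ (curve_length g < +oo)%E.

(* A finite or countably infinite family of curves is indexed by a subset
   [D] of the natural numbers. *)
Definition total_length (R : realType) (D : set nat)
    (gamma : nat -> R -> R * R) : \bar R :=
  (\esum_(i in D) curve_length (gamma i))%E.

Definition rectifiable_family (R : realType) (D : set nat)
    (gamma : nat -> R -> R * R) : Prop :=
  (forall i, D i -> rectifiable_curve (gamma i)) /\
  (total_length D gamma < +oo)%E.

Definition curves_union (R : realType) (D : set nat)
    (gamma : nat -> R -> R * R) : set (R * R) :=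
  \bigcup_(i in D) (gamma i @` `[0, 1]).

Definition is_line (R : realType) (L : set (R * R)) : Prop :=
  exists a b c : R,
    (a, b) != (0, 0) /\ L = [set p | a * p.1 + b * p.2 = c].

Definition barrier (R : realType) (C Gamma : set (R * R)) : Prop :=
  forall L : set (R * R), is_line L -> L `&` C !=set0 -> L `&` Gamma !=set0.

(* A convex body is closed, so its interior together with its boundary is
   the body itself. *)
Definition interior_barrier (R : realType) (C Gamma : set (R * R)) : Prop :=
  barrier C Gamma /\ Gamma `<=` C.

Definition unit_square (R : realType) : set (R * R) := `[0, 1] `*` `[0, 1].
Arguments unit_square R : clear implicits.

(* Main.v *)
(** Suppose that the length is less than 2 + 10^-5. For a vector (u, v),
    |u| + |v| + 299/2 (|u + v| + |u - v|) <= (300 + 1/600) |(u, v)|, and since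
    all lines of slope 1 and -1 through the square are met, the curves have
    total variation at least 2 in each of the directions x + y and x - y. So the
    sum of their total variations in the directions x and y is at most 2.0064.
    Cutting the curves into short pieces, and using that the lines through the
    square form a compact set, we get finitely many tiny boxes that meet all
    these lines and have half-sides (in the coordinates of [-1, 1]^2) of sum at
    most 2 + eta with eta = 0.0064. On the other hand the widths and the heights
    of the boxes, projected to the axes, already sum to 1 each. Hence almost all
    lines are met about once.

    Comparing the second moments of the shadows in the directions x, y, x + y
    and x - y, we see that the widths are concentrated near the bottom and the
    top of the square, and the heights near the left and the right side. If both
    the bottom and the top carried much width, many lines would be met twice,
    namely those through a box near the bottom and a box near the top. In the
    grid of lines given by their endpoints on the bottom and top sides, boxes
    near the bottom and the top are two families of strips, and the lines in the
    crossings of the strips are met in excess. Windows around the crossings,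
    selected as in Besicovitch's covering theorem, show that the product of the
    two masses is at most a constant times the small total excess. Therefore one
    of the bottom and the top side, and one of the left and the right side,
    carries only little mass, and the opposite side most of it. The two sides
    with most of the mass have a common corner, and the lines of slope 1 or -1
    which cut off that corner would have to be met more than once on average. *)
Require Import Defs.
From HB Require Import structures.
From mathcomp Require Import all_boot all_order all_algebra.
From mathcomp Require Import all_classical all_reals all_analysis.
From mathcomp Require Import zify ring lra.
Set Implicit Arguments.
Unset Strict Implicit.
Unset Printing Implicit Defensive.
Import Order.TTheory GRing.Theory Num.Theory.
Import numFieldNormedType.Exports.
Local Open Scope ring_scope.

Local Notation TV := total_variation.

(** * Selection of windows in a grid *)

Section Selection.
Local Open Scope nat_scope.

Lemma count_pairwise_le1 (T : eqType) (e : rel T) (p : pred T) (t : seq T) :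
  pairwise e t -> (forall c d, p c -> p d -> ~~ e c d) -> count p t <= 1.
Proof.
move=> + pe; elim: t => //= c t IH /andP[ct /IH {}IH].
case: (boolP (p c)) => pc //; rewrite add1n ltnS leqn0.
rewrite -leqn0 leqNgt -has_count; apply/hasPn => d dt.
by apply/negP => pd; move: (pe _ _ pc pd); rewrite (allP ct).
Qed.

Variables (M : nat).
Local Notation G := ('I_M * 'I_M)%type.

(** The ball of radius [k] about [z] in the sup norm, written without truncated subtraction. *)
Definition in_window (k : nat) (z y : G) : bool :=
  [&& z.1 <= y.1 + k, y.1 <= z.1 + k, z.2 <= y.2 + k & y.2 <= z.2 + k].

Lemma in_window_refl k z : in_window k z z.
Proof. by rewrite /in_window !leq_addr. Qed.

(** Greedy choice: keep the centre with the largest radius, discard all points of its window, and go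
    on with the rest. *)
Lemma window_selection_sorted (r : G -> nat) (s : seq G) :
  pairwise (fun c d => r d <= r c) s ->
  exists t : seq G, [/\ {subset t <= s},
    forall z, z \in s -> exists2 c, c \in t & in_window (r c) c z &
    pairwise (fun c d => (r d <= r c) && ~~ in_window (r c) c d) t].
Proof.
have [n] := ubnP (size s); elim: n s => // n IH [|c s] /=; first by exists [::].
rewrite ltnS => sn /andP[cs ps].
have [||t [ts tcov te]] := IH [seq d <- s | ~~ in_window (r c) c d].
- by rewrite size_filter (leq_ltn_trans (count_size _ _)).
- exact: pairwise_filter.
exists (c :: t); split=> /=.
- move=> d; rewrite !inE => /predU1P[->|/ts]; first by rewrite eqxx.
  by rewrite mem_filter => /andP[_ ->]; rewrite orbT.
- move=> z; rewrite inE => /predU1P[->|zs].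
    by exists c; rewrite ?mem_head ?in_window_refl.
  have [cz|cz] := boolP (in_window (r c) c z); first by exists c; rewrite ?mem_head.
  have [|d dt dz] := tcov z; first by rewrite mem_filter cz.
  by exists d; rewrite // inE dt orbT.
- rewrite te andbT; apply/allP => d /ts; rewrite mem_filter => /andP[-> ds].
  by rewrite (allP cs).
Qed.

(* A point [y] lies in at most one selected window whose centre is in a given
   quadrant at [y]: of two such centres, the later one would belong to the
   larger window of the earlier one. *)
Lemma window_selection (r : G -> nat) (s : seq G) :
  exists t : seq G, [/\ {subset t <= s},
    forall z, z \in s -> exists2 c, c \in t & in_window (r c) c z &
    forall y, count (fun c => in_window (r c) c y) t <= 4].
Proof.
pose ord c d := r d <= r c.
have [|t [ts tcov te]] := @window_selection_sorted r (sort ord s).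
  rewrite -sorted_pairwise; first by apply: sort_sorted => c d; rewrite /ord leq_total.
  by move=> c d f; rewrite /ord => h1 h2; exact: leq_trans h2 h1.
exists t; split=> [z /ts|z zs|y]; first by rewrite mem_sort.
  by apply: tcov; rewrite mem_sort.
pose quad (u v : bool) c := [&& in_window (r c) c y, (c.1 <= y.1) == u & (c.2 <= y.2) == v].
have q1 u v : count (quad u v) t <= 1.
  apply: count_pairwise_le1 te _ => c d.
  case/and3P=> /and4P[c1 c2 c3 c4] cu cv /and3P[/and4P[d1 d2 d3 d4] du dv].
  rewrite negb_and negbK -implybE; apply/implyP => rdc.
  by rewrite /in_window; case: u v cu cv du dv => -[] /eqP cu /eqP cv /eqP du /eqP dv; lia.
have -> : count (fun c => in_window (r c) c y) t =
    count (quad true true) t + count (quad true false) t +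
    (count (quad false true) t + count (quad false false) t).
  elim: t {ts tcov te q1} => //= c t ->; rewrite /quad.
  by case: in_window; case: (c.1 <= _); case: (c.2 <= _) => /=; lia.
by move: (q1 true true) (q1 true false) (q1 false true) (q1 false false); lia.
Qed.
End Selection.

(** * Strips in the grid and the number of their points *)

Section Strips.
Variable R : realType.

(** Integrality lets the enlarged radius [8 k / 7] be rounded down to [k + k %/ 7]. *)
Lemma dist_seventh (t z : int) (k : nat) :
  `|7 * (t - z)| <= 8 * k%:Z -> `|t - z| <= (k + k %/ 7)%:Z.
Proof.
rewrite normrM ger0_norm//; move: `|t - z| => d.
have := divn_eq k 7; have := ltn_mod k 7.
by move: (k %/ 7)%N (k %% 7)%N => u v; lia.
Qed.

(* A step of at most [1] visits an interval of length [q] at least [q - 1]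
   times. *)
Lemma count_progression (M q : nat) (A c : R) (P : pred 'I_M) :
  0 < A <= 1 ->
  (forall x : int, 0 <= A * x%:~R + c < q%:R -> 0 <= x < M%:Z) ->
  (forall a : 'I_M, 0 <= A * a%:R + c < q%:R -> P a) ->
  (q.-1 <= #|P|)%N.
Proof.
move=> /andP[A0 A1] rng AP.
pose a1 := Num.ceil (- c / A).
have a1l : - c <= A * a1%:~R by rewrite mulrC -ler_pdivrMr// Num.Theory.ceil_ge.
have a1u : A * a1%:~R < - c + A.
  have : a1%:~R < - c / A + 1.
    have := Num.Theory.ceilB1_lt (- c / A); rewrite intrD -/a1.
    by lra.
  by rewrite -(ltr_pM2l A0) mulrDr mulr1 mulrCA mulfV ?gt_eqF// mulr1.
have at_in (t : nat) : (t < q.-1)%N -> 0 <= A * (a1 + t%:Z)%:~R + c < q%:R.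
  move=> tq; have t0 : 0 <= t%:R :> R by exact: ler0n.
  have tq1 : t%:R + 2 <= q%:R :> R by rewrite -natrD ler_nat; lia.
  by rewrite intrD mulrDr; apply/andP; split; nra.
have at_M (t : 'I_q.-1) : (absz (a1 + t%:Z)%R < M)%N.
  by have /rng := at_in t (ltn_ord t); lia.
pose f t := Ordinal (at_M t).
have fi : injective f.
  move=> t t' /(congr1 val) /= tt'; apply/val_inj => /=.
  have /rng := at_in t (ltn_ord t); have /rng := at_in t' (ltn_ord t').
  by move: tt'; lia.
rewrite -[q.-1]card_ord -(fintype.card_image fi); apply: fintype.subset_leq_card.
apply/fintype.subsetP => x /fintype.imageP[t _ ->].
apply: AP; have h := at_in t (ltn_ord t); have /rng h' := h.
have <- : (a1 + t%:Z)%:~R = (f t)%:R :> R; last by [].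
rewrite /f /= -[RHS]/((absz (a1 + t%:Z))%:~R); congr (_%:~R).
by move: h'; lia.
Qed.

Lemma card_row M k (c : 'I_M) : (k <= c)%N -> (c + k < M)%N ->
  #|[pred a : 'I_M | (c <= a + k)%N && (a <= c + k)%N]| = (2 * k + 1)%N.
Proof.
move=> kc ckM.
have at_M (t : 'I_(2 * k + 1)) : (c - k + t < M)%N by have := ltn_ord t; lia.
pose f t := Ordinal (at_M t).
have fi : injective f by move=> t t' /(congr1 val) /= tt'; apply/val_inj => /=; lia.
rewrite -[RHS]card_ord -(fintype.card_image fi); apply: eq_card => a; rewrite inE.
apply/idP/fintype.imageP => [/andP[h1 h2]|[t _ ->] /=]; last by have := ltn_ord t; lia.
have tP : (a - (c - k) < 2 * k + 1)%N by lia.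
by exists (Ordinal tP) => //; apply/val_inj => /=; lia.
Qed.

Definition central M k (z : 'I_M * 'I_M) :=
  [&& (k <= z.1)%N, (z.1 + k < M)%N, (k <= z.2)%N & (z.2 + k < M)%N].

Lemma card_window M k (z : 'I_M * 'I_M) : central k z ->
  #|in_window k z| = ((2 * k + 1) ^ 2)%N.
Proof.
case/and4P=> h1 h2 h3 h4; rewrite -mulnn -{1}(card_row h1 h2) -(card_row h3 h4).
rewrite -cardX; apply: eq_card => -[a b]; rewrite !inE /in_window /=.
by rewrite -!andbA.
Qed.

(** In the application [y] holds the two ends of a line on the bottom and the top side, and
    [A * y.1 + (1 - A) * y.2] is its abscissa at a fixed height. Lines passing near a point of that
    height thus form a strip, nearly parallel to an axis of the grid if [A] is near [1]. *)
Definition on_strip M (A x w : R) (y : 'I_M * 'I_M) : bool :=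
  `|A * y.1%:R + (1 - A) * y.2%:R - x| <= w.

(* The line [A a + (1 - A) b = m q] of a strip, at distance [g] from its edges. *)
Definition inner_line M (q : nat) (g : R) (x w : R) (m : 'I_M) : bool :=
  (x - w + g <= (m * q)%:R <= x + w - g).

(** A sampled line through the window carries a cell of width [q] inside its strip. The cell has at
    least [q - 1] points in each of the [2 k + 1] rows, and as it is almost perpendicular to the
    rows, these points stay in the window enlarged by [8/7]. *)
Lemma strip_mass (I : finType) (M q k : nat) (A x w : I -> R) (g : R)
    (z : 'I_M * 'I_M) (Bs : pred (I * 'I_M)) :
  (forall i, 19 / 20 <= A i <= 1) -> q%:R <= g ->
  (42 * q.+1 <= k)%N -> central (k + k %/ 7) z ->
  (forall i m, Bs (i, m) -> inner_line q g (x i) (w i) m /\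
     exists2 y, in_window k z y & on_strip (A i) (m * q)%:R 1 y) ->
  (#|Bs| * ((2 * k + 1) * q.-1) <=
   \sum_(y | in_window (k + k %/ 7) z y) #|[pred i | on_strip (A i) (x i) (w i) y]|)%N.
Proof.
move=> hA qg qk zc hB.
(* Cells are half-open, so the cells of different lines of one strip are disjoint. *)
pose cell (b : I * 'I_M) (y : 'I_M * 'I_M) :=
  0 <= A b.1 * y.1%:R + (1 - A b.1) * y.2%:R - (b.2 * q)%:R < q%:R.
have cell_count b : Bs b ->
    ((2 * k + 1) * q.-1 <= \sum_(y | in_window (k + k %/ 7) z y) cell b y)%N.
  case: b => i m /hB [_ [y1 y1z y1m]].
  have -> : (\sum_(y | in_window (k + k %/ 7) z y) cell (i, m) y =
      \sum_(r : 'I_M) \sum_(a | in_window (k + k %/ 7) z (a, r)) cell (i, m) (a, r))%N.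
    rewrite pair_big_dep (reindex (fun p : 'I_M * 'I_M => (p.2, p.1))) /=.
      by [].
    by exists (fun p : 'I_M * 'I_M => (p.2, p.1)) => -[].
  case/and4P: (zc) => z1 z2 z3 z4.
  rewrite -(@card_row M k z.2); [|lia|lia].
  rewrite -sum_nat_const.
  rewrite [leqRHS](bigID (fun r : 'I_M => (z.2 <= r + k)%N && (r <= z.2 + k)%N)) /=.
  apply: leq_trans (leq_addr _ _); apply: leq_sum => r /andP[r1 r2].
  have -> : (\sum_(a | in_window (k + k %/ 7) z (a, r)) cell (i, m) (a, r) =
     #|[pred a | in_window (k + k %/ 7) z (a, r) && cell (i, m) (a, r)]|)%N.
    rewrite -sum1_card [RHS]big_mkcond [LHS]big_mkcond; apply: eq_bigr => a _.
    by rewrite inE; case: in_window; case: cell.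
  have A1 := hA i; have {}y1m : `|A i * y1.1%:R + (1 - A i) * y1.2%:R - (m * q)%:R| <= 1 by [].
  (* The cell and the rounding contribute [q + 1 <= k / 42], the slope at most [2 k / 20]; divided
     by [19/20] this is less than [k / 7]. *)
  have key (t : int) : 0 <= A i * t%:~R + ((1 - A i) * r%:R - (m * q)%:R) < q%:R ->
      `|t - z.1%:Z| <= (k + k %/ 7)%:Z.
    move=> hx.
    have bd (u v : nat) (d : nat) : (u <= v + d)%N -> u%:R <= v%:R + d%:R :> R.
      by rewrite -natrD ler_nat.
    case/and4P: y1z => /bd n1 /bd n2 /bd n3 /bd n4.
    move: (r1) (r2) => /bd r1' /bd r2'.
    have qk' : 42 * (q%:R + 1) <= k%:R :> R.
      by move: qk; rewrite -(ler_nat R) natrM -natr1; lra.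
    have k0 : 0 <= k%:R :> R by exact: ler0n.
    have hd : `|(1 - A i) * (r%:R - y1.2%:R)| <= 1 / 20 * (2 * k%:R).
      rewrite normrM; apply: ler_pM; rewrite ?normr_ge0//.
        by rewrite ler_norml; lra.
      by rewrite ler_norml; lra.
    have h7 : 7 * `|t%:~R - z.1%:R| <= 8 * k%:R :> R.
      suff : `|t%:~R - y1.1%:R| <= k%:R / 7 :> R.
        move=> h; suff : `|t%:~R - z.1%:R| <= 8 * k%:R / 7 :> R by lra.
        by move: h; rewrite !ler_norml; lra.
      have hA2 : `|A i * (t%:~R - y1.1%:R)| <= q%:R + 1 + 1 / 20 * (2 * k%:R).
        by move: hd y1m hx; rewrite !ler_norml; lra.
      have : 19 / 20 * `|t%:~R - y1.1%:R| <= `|A i * (t%:~R - y1.1%:R)|.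
        rewrite normrM ler_wpM2r// ler_normr; lra.
      lra.
    have : `|7 * (t - z.1%:Z)|%:~R <= (8 * k%:Z)%:~R :> R.
      by rewrite intr_norm !intrM intrB normrM ger0_norm// -!pmulrn.
    by rewrite ler_int => /dist_seventh.
  apply: (@count_progression M q (A i) ((1 - A i) * r%:R - (m * q)%:R)); first lra.
    by move=> t /key; lia.
  move=> a ha; rewrite inE; apply/andP; split; last by rewrite /cell /=; lra.
  by have := key a%:Z ha; rewrite /in_window /=; move: r1 r2; clear; lia.
have cell_mult y : (\sum_(b | Bs b) cell b y <=
    #|[pred i | on_strip (A i) (x i) (w i) y]|)%N.
  rewrite -big_mkcondr /= sum1_card.
  have fst_inj : {in [pred b | Bs b & cell b y] &, injective (fun b : I * 'I_M => b.1)}.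
    move=> [i m] [i' m']; rewrite !inE /cell /= => /andP[_ h] /andP[_ h'] ii'.
    subst i'; congr (_, _); apply/val_inj => /=.
    have h1 : (m * q)%:R < (m' * q)%:R + q%:R :> R by lra.
    have h2 : (m' * q)%:R < (m * q)%:R + q%:R :> R by lra.
    by move: h1 h2; rewrite -!natrD !ltr_nat; nia.
  rewrite -(fintype.card_in_image fst_inj); apply: fintype.subset_leq_card.
  apply/fintype.subsetP => i /fintype.imageP[[i' m]].
  rewrite !inE /cell /= => /andP[/hB [+ _] h] ->.
  rewrite /inner_line /on_strip ler_norml => h'.
  by apply/andP; split; lra.
rewrite -sum_nat_const; apply: leq_trans (leq_sum _ cell_count) _.
by rewrite exchange_big; apply: leq_sum => y _; exact: cell_mult.
Qed.
End Strips.

(** * Crossings of two families of strips *)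

Section Crossings.
Variable R : realType.
Local Open Scope nat_scope.

Definition swap (T : Type) (z : T * T) := (z.2, z.1).

Lemma in_window_swap M k (z y : 'I_M * 'I_M) : in_window k (swap z) (swap y) = in_window k z y.
Proof. by rewrite /in_window /= andbA andbC -andbA. Qed.

Lemma central_swap M k (z : 'I_M * 'I_M) : central k (swap z) = central k z.
Proof. by rewrite /central /= andbA andbC -andbA. Qed.

(** A move by at most [k] in both coordinates changes the convex combination by at most [k]; the
    margin [g] absorbs this and the tolerance [1]. *)
Lemma on_strip_window M k q (A x w g : R) (m : 'I_M) (z y : 'I_M * 'I_M) :
  (0 <= A <= 1)%R -> (k.+1%:R <= g)%R -> inner_line q g x w m ->
  on_strip A (m * q)%:R 1 z -> in_window k z y -> on_strip A x w y.
Proof.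
move=> hA kg; rewrite /inner_line /on_strip => hm hz.
have bd (a b : nat) (d : nat) : a <= b + d -> (a%:R <= b%:R + d%:R :> R)%R.
  by rewrite -natrD ler_nat.
case/and4P=> /bd n1 /bd n2 /bd n3 /bd n4.
have A0 : (0 <= A)%R by lra.
have A1 : (0 <= 1 - A)%R by lra.
have d1 : (`|A * (y.1%:R - z.1%:R)| <= A * k%:R)%R.
  by rewrite normrM (ger0_norm A0); apply: ler_wpM2l => //; rewrite ler_norml; lra.
have d2 : (`|(1 - A) * (y.2%:R - z.2%:R)| <= (1 - A) * k%:R)%R.
  by rewrite normrM (ger0_norm A1); apply: ler_wpM2l => //; rewrite ler_norml; lra.
by move: d1 d2 kg hz; rewrite -natr1 !ler_norml; lra.
Qed.

(** [X] and [Y] are the sides of a window and of its enlargement, [b] and [c] the numbers of lines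
    of the two families through the window. The density bound gives [(b + c) * 49 q <= 128 X], and
    AM-GM does the rest. *)
Lemma window_arith (b c s X Y q : nat) :
  7 * Y <= 8 * X -> X ^ 2 <= s -> b * (X * q) + c * (X * q) <= 2 * Y ^ 2 -> 0 < X ->
  b * c * (q * 49) ^ 2 <= 64 ^ 2 * s.
Proof.
move=> h7 gz hbc X0.
have h1 : (b + c) * (q * 49) <= 128 * X.
  rewrite -(leq_pmul2l X0).
  have h3 : 49 * (2 * Y ^ 2) <= X * (128 * X).
    apply: (@leq_trans (2 * (8 * X) ^ 2)); last by rewrite -mulnn; lia.
    by rewrite mulnCA leq_pmul2l// -[49]/(7 ^ 2) -expnMn leq_exp2r.
  apply: leq_trans _ h3; have := hbc; move: (2 * Y ^ 2) => T; lia.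
have h2 : 4 * (b * c) <= (b + c)^2 by exact: nat_AGM2.
rewrite -(@leq_pmul2l 4)//.
apply: (@leq_trans ((b + c)^2 * (q * 49)^2)).
  by rewrite mulnA leq_mul2r h2 orbT.
rewrite -expnMn; apply: (@leq_trans ((128 * X)^2)); first by rewrite leq_exp2r.
by rewrite expnMn mulnA leq_mul.
Qed.

(* A pair of inner lines of the two families crosses at a point [z] around
   which [e] is at least [1]. Take the largest window at [z] on which [e] has
   mean at least [1]. On the window enlarged by the factor [8/7] the mean is less
   than [1], so the strips of the two families have there total density at most
   [2]; by AM-GM the number of pairs of lines through the window is at most a
   constant times the sum of [e] over it. A selection of these windows covers
   all crossings, with multiplicity at most [4]. *)
Lemma crossing_count (I J : finType) (M q k0 K : nat) (A x w : I -> R)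
    (C y v : J -> R) (g : R) (e : 'I_M * 'I_M -> nat) :
  (forall i, 19 / 20 <= A i <= 1)%R -> (forall j, 19 / 20 <= C j <= 1)%R ->
  (q%:R <= g)%R -> (k0.+1%:R <= g)%R -> 42 * q.+1 <= k0 -> k0 <= K ->
  (forall z : 'I_M * 'I_M, #|[pred i | on_strip (A i) (x i) (w i) z]| +
     #|[pred j | on_strip (C j) (y j) (v j) (swap z)]| <= (e z).+1) ->
  (forall k, (2 * k + 1) ^ 2 <= \sum_z e z -> k + k %/ 7 <= K) ->
  (forall i (m : 'I_M) j (l : 'I_M), inner_line q g (x i) (w i) m -> inner_line q g (y j) (v j) l ->
     exists z : 'I_M * 'I_M, [/\ central K z, on_strip (A i) (m * q)%:R 1 z &
       on_strip (C j) (l * q)%:R 1 (swap z)]) ->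
  #|[pred b : I * 'I_M | inner_line q g (x b.1) (w b.1) b.2]| *
  #|[pred b : J * 'I_M | inner_line q g (y b.1) (v b.1) b.2]| * (q.-1 * 49) ^ 2 <=
  4 * 64 ^ 2 * \sum_z e z.
Proof.
move=> hA hC qg k0g qk0 k0K he hK cross.
pose G := ('I_M * 'I_M)%type.
pose PB := [pred b : I * 'I_M | inner_line q g (x b.1) (w b.1) b.2].
pose PT := [pred b : J * 'I_M | inner_line q g (y b.1) (v b.1) b.2].
rewrite -/PB -/PT.
pose onB (b : I * 'I_M) (z : G) := on_strip (A b.1) (b.2 * q)%:R 1 z.
pose onT (b : J * 'I_M) (z : G) := on_strip (C b.1) (b.2 * q)%:R 1 (swap z).
pose S (z : G) k := \sum_(y | in_window k z y) e y.
pose good (z : G) k := (2 * k + 1) ^ 2 <= S z k.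
have SE z k : S z k <= \sum_z e z.
  by rewrite /S [leqRHS](bigID (in_window k z)) leq_addr.
pose rad (z : G) := \max_(k < K.+1 | good z k) k.
pose isE := [pred z : G | [exists p : (I * 'I_M) * (J * 'I_M),
  [&& PB p.1, PT p.2, central K z, onB p.1 z & onT p.2 z]]].
have centralW k z : k <= K -> central K z -> central k z.
  by move=> kK /and4P[h1 h2 h3 h4]; rewrite /central; lia.
have goodE z : isE z -> [/\ central (rad z + rad z %/ 7) z, k0 <= rad z,
    good z (rad z) & ~~ good z (rad z + rad z %/ 7)].
  case/existsP => -[[i m] [j l]] /and5P[/= Bm Tl zK zB zT].
  (* The margins make both strips contain the whole window of radius [k0], so [e] is at least [1] on
     it. *)
  have good0 : good z k0.
    rewrite /good -(card_window (centralW _ _ _ k0K zK)) -sum1_card.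
    apply: leq_sum => z' zz'.
    have iB : i \in [pred i | on_strip (A i) (x i) (w i) z'].
      by rewrite inE; apply: on_strip_window k0g Bm zB zz'; have := hA i; lra.
    have jT : j \in [pred j | on_strip (C j) (y j) (v j) (swap z')].
      rewrite inE; apply: on_strip_window k0g Tl zT _; first by have := hC j; lra.
      by rewrite in_window_swap.
    have := he z'; rewrite (cardD1 i) iB (cardD1 j) jT.
    by rewrite !add1n addSn addnS ltnS; exact: leq_trans.
  have k0r : k0 <= rad z.
    by apply: (@leq_bigmax_cond _ (fun k : 'I_K.+1 => good z k) val (Ordinal (k0K : k0 < K.+1))).
  have gr : good z (rad z).
    have [|k gk rk] := @eq_bigmax_cond _ (fun k : 'I_K.+1 => good z k) val.
      by apply/card_gt0P; exists (Ordinal (k0K : k0 < K.+1)).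
    suff -> : rad z = k by [].
    by rewrite -rk; exact: eq_bigl.
  (* The total of [e] keeps the enlarged radius within the range of the maximum, so maximality makes
     [good] fail there. *)
  have rK : rad z + rad z %/ 7 <= K by apply: hK; exact: leq_trans gr (SE _ _).
  split=> //; first exact: centralW zK.
  apply/negP => gk.
  have : rad z + rad z %/ 7 <= rad z.
    by apply: (@leq_bigmax_cond _ (fun k : 'I_K.+1 => good z k) val (Ordinal (rK : _ < K.+1))).
  have : 1 <= rad z %/ 7 by rewrite divn_gt0//; move: k0r qk0; clear; lia.
  by move=> d1; apply/negP; rewrite -ltnNge -{1}[rad z]addn0 ltn_add2l.
pose Bs z := [pred b | PB b && [exists y, in_window (rad z) z y && onB b y]].
pose Ts z := [pred b | PT b && [exists y, in_window (rad z) z y && onT b y]].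
have prodE z : isE z -> #|Bs z| * #|Ts z| * (q.-1 * 49) ^ 2 <= 64 ^ 2 * S z (rad z).
  move=> zE; have [zc kr gz ngz] := goodE _ zE.
  have hB := @strip_mass R I M q (rad z) A x w g z (Bs z) hA qg (leq_trans qk0 kr) zc.
  have {}hB : #|Bs z| * ((2 * rad z + 1) * q.-1) <= \sum_(y | in_window (rad z + rad z %/ 7) z y)
     #|[pred i | on_strip (A i) (x i) (w i) y]|.
    by apply: hB => i m /andP[Pm /existsP[y1 /andP[y1z y1m]]]; split=> //; exists y1.
  have hT : #|Ts z| * ((2 * rad z + 1) * q.-1) <= \sum_(y0 | in_window (rad z + rad z %/ 7) z y0)
     #|[pred j | on_strip (C j) (y j) (v j) (swap y0)]|.
    have := @strip_mass R J M q (rad z) C y v g (swap z) (Ts z) hC qg (leq_trans qk0 kr).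
    rewrite central_swap => /(_ zc) h; apply: leq_trans (h _) _.
      move=> j l /andP[Pl /existsP[y1 /andP[y1z y1m]]]; split=> //.
      by exists (swap y1); rewrite ?in_window_swap.
    rewrite (reindex (@swap 'I_M)) /=; last by exists (@swap 'I_M) => -[].
    by apply: eq_leq; apply: eq_bigl => y1; rewrite in_window_swap.
  have : #|Bs z| * ((2 * rad z + 1) * q.-1) + #|Ts z| * ((2 * rad z + 1) * q.-1) <=
      2 * (2 * (rad z + rad z %/ 7) + 1) ^ 2.
    apply: leq_trans (leq_add hB hT) _; rewrite -big_split /=.
    apply: leq_trans (leq_sum _ (fun y1 _ => he y1)) _.
    under eq_bigr do rewrite -add1n.
    rewrite big_split /= sum1_card card_window// [leqRHS]mulSn mul1n leq_add2l.
    by apply: ltnW; rewrite ltnNge; exact: ngz.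
  move: gz; rewrite /good.
  move: #|Bs z| #|Ts z| (S z (rad z)) => b c s gz hbc.
  have h7 : 7 * (2 * (rad z + rad z %/ 7) + 1) <= 8 * (2 * rad z + 1).
    by have := divn_eq (rad z) 7; move: (rad z %/ 7) (rad z %% 7) => *; lia.
  by apply: window_arith h7 gz hbc _; rewrite addn1.
have [t [ts tcov tcount]] := window_selection rad (enum isE).
have tE c : c \in t -> isE c by move/ts; rewrite mem_enum.
(* The crossing of a pair lies in some selected window, and both lines then pass through that
   window. *)
have cover : #|PB| * #|PT| <= \sum_(c <- t) #|Bs c| * #|Ts c|.
  have -> : #|PB| * #|PT| = #|[pred p | PB p.1 && PT p.2]|.
    by rewrite -cardX; apply: eq_card => p; rewrite !inE.
  have -> : \sum_(c <- t) #|Bs c| * #|Ts c| =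
      \sum_(c <- t) \sum_p (Bs c p.1 && Ts c p.2).
    apply: eq_bigr => c _; rewrite -cardX -sum1_card big_mkcond /=.
    by apply: eq_bigr => p _; rewrite -[_ \in _]/(Bs c p.1 && Ts c p.2); case: (_ && _).
  rewrite exchange_big /= -sum1_card big_mkcond /=; apply: leq_sum => -[[i m] [j l]] _.
  case: ifP => // /andP[/= Pm Pl].
  have [z [zK zB zT]] := cross _ _ _ _ Pm Pl.
  have zE : z \in enum isE.
    rewrite mem_enum; apply/existsP; exists ((i, m), (j, l)).
    by apply/and5P.
  have [c ct cz] := tcov _ zE.
  rewrite (big_rem c ct) ltn_addr// lt0b; apply/andP.
  by split; apply/andP; split=> //; apply/existsP; exists z; rewrite cz.
have mult : \sum_(c <- t) S c (rad c) <= 4 * \sum_z e z.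
  under eq_bigr do rewrite /S big_mkcond /=.
  rewrite exchange_big /= big_distrr /=; apply: leq_sum => y1 _.
  by rewrite -big_mkcond big_const_seq iter_addn_0 mulnC leq_mul.
apply: leq_trans (leq_mul cover (leqnn _)) _.
rewrite big_distrl /= mulnAC; apply: leq_trans _ (leq_mul mult (leqnn _)).
rewrite big_distrl /= !big_seq; apply: leq_sum => c /tE /prodE.
by rewrite [_ * 64 ^ 2]mulnC.
Qed.
End Crossings.

(** * Boxes meeting the lines through the square *)

Section Covers.
Variables (R : realType) (J : finType).
Implicit Types (u v : J -> R) (G : R -> R) (P : pred J) (D : pred R).

(** Subadditivity of the measure with distribution function [G]. The interval reaching furthest
    right is removed and the target is cut at its left end; the target is half-open so that the
    other intervals cover what remains. *)
Lemma cover_sum u v G D P al be :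
  (forall j, u j <= v j) -> (forall j, D (u j)) -> (forall j, D (v j)) ->
  (forall s t, D s -> D t -> s <= t -> G s <= G t) ->
  D al -> D be -> al <= be ->
  (forall t, al <= t < be -> exists2 j, P j & u j <= t <= v j) ->
  G be - G al <= \sum_(j | P j) (G (v j) - G (u j)).
Proof.
move=> uv Du Dv mG Dal; have [n] := ubnP #|P|.
elim: n P be => // n IH P be Pn Dbe ab cov.
have G0 j : 0 <= G (v j) - G (u j) by rewrite subr_ge0; apply: mG.
have [ab'|ab'] := eqVneq al be.
  by rewrite ab' subrr; apply: sumr_ge0.
have {}ab' : al < be by rewrite lt_neqAle ab'.
have [|j0 Pj0 _] := cov al; first by lra.
have [j Pj jmax] := Order.TotalTheory.arg_maxP v Pj0.
have bj : be <= v j.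
  rewrite leNgt; apply/negP => jb.
  (* If all intervals ended before [be], this point beyond the furthest end would be missed. *)
  have [|j' Pj' j't] := cov (Num.max al ((v j + be) / 2)).
    by rewrite le_max lexx gt_max; lra.
  have jj' : v j' <= v j := jmax _ Pj'.
  by move: j't; rewrite ge_max; lra.
have [uj|uj] := leP (u j) al.
  rewrite (bigD1 j)//= -[leLHS]addr0; apply: lerD; last exact: sumr_ge0.
  have h1 : G be <= G (v j) by apply: mG.
  have h2 : G (u j) <= G al by apply: mG.
  by lra.
pose b := Num.min (u j) be.
have ub : b <= u j by rewrite ge_min lexx.
have bb : b <= be by rewrite ge_min lexx orbT.
have Db : D b by rewrite /b; case: leP.
have hb : G be - G b <= G (v j) - G (u j).
  rewrite /b; case: (leP (u j) be) => h; last by rewrite subrr.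
  by have h1 : G be <= G (v j) by [apply: mG]; lra.
have ih : G b - G al <= \sum_(i | P i && (i != j)) (G (v i) - G (u i)).
  apply: IH => //; [|by rewrite le_min; lra|].
  - rewrite (cardD1 j) unfold_in Pj add1n ltnS in Pn.
    apply: leq_ltn_trans Pn; rewrite leq_eqVlt; apply/orP; left; apply/eqP.
    by apply: eq_card => i; rewrite !inE andbC.
  - move=> t tb; have [|i Pi it] := cov t; first lra.
    exists i => //; rewrite Pi; apply/eqP => ij; move: it; rewrite ij; lra.
rewrite (bigD1 j)//=; lra.
Qed.

Definition clamp (p q t : R) := Num.min (Num.max t p) q.
(** The length of the intersection of [[p, q]] and [[u, v]], as an increment of a monotone function
    to which [cover_sum] applies. *)
Definition overlap (p q u v : R) := clamp p q v - clamp p q u.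

Lemma clampE p q t : p <= q ->
  clamp p q t = if t <= p then p else if t <= q then t else q.
Proof.
by rewrite /clamp => pq; case: (leP t p) => tp; case: leP => //; case: leP => //; lra.
Qed.

Lemma clamp_mono p q s t : p <= q -> s <= t ->
  0 <= clamp p q t - clamp p q s <= t - s.
Proof.
move=> pq st; rewrite !clampE//.
by case: (leP t p); case: (leP t q); case: (leP s p); case: (leP s q); lra.
Qed.

Lemma overlap_ge0 p q s t : p <= q -> s <= t -> 0 <= overlap p q s t.
Proof. by move=> pq /(clamp_mono pq)/andP[]. Qed.

Lemma overlap_lower u v p q : p <= q -> (forall j, u j <= v j) ->
  (forall t, p <= t <= q -> exists j, u j <= t <= v j) ->
  q - p <= \sum_j overlap p q (u j) (v j).
Proof.
move=> pq uv cov; have -> : q - p = clamp p q q - clamp p q p.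
  by rewrite !clampE// !lexx; case: (leP q p); lra.
apply: (@cover_sum u v (clamp p q) predT predT p q uv) => // [s t _ _ st|t tp].
  by have := clamp_mono pq st; lra.
by have [|j hj] := cov t; [lra|exists j].
Qed.

(** The part of [[al, be]] outside [[p, q]] has to be covered as well, which is measured by
    [t - clamp p q t]; only the rest of the total length is left for [[p, q]]. *)
Lemma overlap_upper u v p q al be : al <= p -> p <= q -> q <= be ->
  (forall j, u j <= v j) ->
  (forall t, al <= t <= be -> exists j, u j <= t <= v j) ->
  \sum_j overlap p q (u j) (v j) <= \sum_j (v j - u j) - (be - al) + (q - p).
Proof.
move=> alp pq qbe uv cov.
have : (be - clamp p q be) - (al - clamp p q al) <=
    \sum_j ((v j - clamp p q (v j)) - (u j - clamp p q (u j))).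
  apply: (@cover_sum u v (fun t => t - clamp p q t) predT predT al be uv) => //.
  - by move=> s t _ _ st; have := clamp_mono pq st; lra.
  - lra.
  - by move=> t ht; have [|j hj] := cov t; [lra|exists j].
have -> : \sum_j ((v j - clamp p q (v j)) - (u j - clamp p q (u j))) =
    \sum_j (v j - u j) - \sum_j overlap p q (u j) (v j).
  by rewrite -sumrB; apply: eq_bigr => j _; rewrite /overlap; lra.
have -> : clamp p q be = q by rewrite clampE//; case: (leP be p); case: (leP be q); lra.
have -> : clamp p q al = p by rewrite clampE//; case: (leP al p); lra.
lra.
Qed.

(** The first and the last point of the progression lie in both intervals, and so does the segment
    between them. *)
Lemma card_progression_le (M : nat) (d : R) (f : 'I_M -> R) (Q : pred 'I_M) p q s t :
  0 < d -> p <= q -> s <= t ->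
  (forall a b : 'I_M, f a - f b = d * (a%:R - b%:R)) ->
  (forall a, Q a -> p <= f a <= q /\ s <= f a <= t) ->
  d * (#|Q|%:R - 1) <= overlap p q s t.
Proof.
move=> d0 pq st fd hQ.
have ov0 := overlap_ge0 pq st.
have [a0 Qa0|Q0] := pickP Q; last first.
  by rewrite eq_card0 // sub0r mulrN1; lra.
have [a Qa amin] := Order.TotalTheory.arg_minP (fun a : 'I_M => val a) Qa0.
have [b Qb bmax] := Order.TotalTheory.arg_maxP (fun a : 'I_M => val a) Qa0.
have {}amin (j : 'I_M) : Q j -> (a <= j)%N := amin j.
have {}bmax (j : 'I_M) : Q j -> (j <= b)%N := bmax j.
have ab : (a <= b)%N by exact: amin.
have cardQ : (#|Q| <= (b - a).+1)%N.
  have hi : {in Q &, injective (fun j : 'I_M => inord (j - a) : 'I_(b - a).+1)}.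
    move=> j j' Qj Qj' /(congr1 val) /=.
    have := amin _ Qj; have := amin _ Qj'; have := bmax _ Qj; have := bmax _ Qj'.
    clear=> h1 h2 h3 h4; rewrite !inordK; [|lia|lia].
    by move=> h5; apply/val_inj => /=; lia.
  by rewrite -(fintype.card_in_image hi) -[leqRHS]card_ord max_card.
have [pa sa] := hQ _ Qa; have [pb sb] := hQ _ Qb.
have fab := fd b a.
have cQ : #|Q|%:R - 1 <= b%:R - a%:R :> R.
  by rewrite -natrB// lerBlDr natr1 ler_nat.
have h : d * (#|Q|%:R - 1) <= f b - f a by rewrite fab ler_pM2l.
have d_ge0 : 0 <= f b - f a by rewrite fab mulr_ge0 ?subr_ge0 ?ler_nat// ltW.
apply: le_trans h _; rewrite /overlap !clampE//.
move: pq st pa sa pb sb d_ge0; clear.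
by case: (leP t p); case: (leP t q); case: (leP s p); case: (leP s q); lra.
Qed.
End Covers.

(** * The grid of lines and its total excess *)

Section Grid.
Variables (R : realType) (J : finType).
Implicit Types X Y W H : J -> R.

(* A family of boxes with centres [(X j, Y j)] and half-sides [W j], [H j]
   meets the line [x + u y = t (1 + |u|)]. As [u] and [t] range over [[-1, 1]],
   these are the lines through the square [[-1, 1]^2] which make an angle of at
   most 45 degrees with the vertical; exchanging the coordinates gives the other
   lines through the square. *)
Definition steep_cover X Y W H := forall u t : R, `|u| <= 1 -> `|t| <= 1 ->
  exists j, `|X j + u * Y j - t * (1 + `|u|)| <= W j + `|u| * H j.

Lemma steep_cover_itv X Y W H u t : steep_cover X Y W H -> `|u| <= 1 ->
  - (1 + `|u|) <= t <= 1 + `|u| -> exists j,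
  X j + u * Y j - (W j + `|u| * H j) <= t <= X j + u * Y j + (W j + `|u| * H j).
Proof.
move=> cov u1 ht; have u0 : 0 < 1 + `|u| by have := normr_ge0 u; lra.
have [|j] := cov u (t / (1 + `|u|)) u1.
  by rewrite normrM normfV [`|1 + _|]gtr0_norm// ler_pdivrMr// mul1r ler_norml.
by rewrite divfK ?gt_eqF// ler_norml => hj; exists j; lra.
Qed.

(** For [n = 2 * N] the terms are the sizes, less one, of the diagonals of the grid. *)
Lemma sum_minn n : (\sum_(k < (2 * n).+1) minn k (2 * n - k) = n ^ 2)%N.
Proof.
elim: n => [|n IH]; first by rewrite big_ord1.
have -> : (2 * n.+1 = (2 * n).+2)%N by lia.
rewrite big_ord_recl big_ord_recr /= min0n add0n.
rewrite (_ : minn _ _ = 0%N) ?addn0; last by rewrite /bump /=; lia.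
rewrite (eq_bigr (fun k : 'I_(2 * n).+1 => 1 + minn k (2 * n - k))%N); last first.
  by move=> k _; have := ltn_ord k; rewrite /bump /=; lia.
by rewrite big_split /= IH sum1_card card_ord -!mulnn; lia.
Qed.

Variables (X Y W H : J -> R) (eta : R) (N : nat).
Hypothesis N0 : (0 < N)%N.
Hypothesis W0 : forall j, 0 <= W j.
Hypothesis H0 : forall j, 0 <= H j.
Hypothesis covX : steep_cover X Y W H.
Hypothesis covY : steep_cover Y X H W.
Hypothesis total : \sum_j (W j + H j) <= 2 + eta.

(** The shadows of the boxes in one direction are intervals which cover the shadow of the square. *)
Lemma sum_steep_ge A B C D (c : R) : (forall j, 0 <= C j) -> (forall j, 0 <= D j) ->
  steep_cover A B C D -> `|c| <= 1 ->
  1 + `|c| <= \sum_j (C j + `|c| * D j).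
Proof.
move=> C0 D0 cov c1.
have c0 : 0 <= `|c| := normr_ge0 c.
have : (1 + `|c|) - - (1 + `|c|) <= \sum_j
    ((A j + c * B j + (C j + `|c| * D j)) - (A j + c * B j - (C j + `|c| * D j))).
  apply: (@cover_sum R J (fun j => A j + c * B j - (C j + `|c| * D j))
    (fun j => A j + c * B j + (C j + `|c| * D j)) id predT predT) => //.
  - by move=> j; have := C0 j; have := mulr_ge0 c0 (D0 j); lra.
  - lra.
  - by move=> t ht; have [|j hj] := steep_cover_itv cov c1 (t := t); [lra|exists j].
rewrite (eq_bigr (fun j => 2 * (C j + `|c| * D j))); last by move=> j _; lra.
by rewrite -mulr_sumr; lra.
Qed.

Local Notation M := (2 * N + 1)%N.

(* The grid point [(a, b)] stands for the line through [(a / N - 1, -1)] and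
   [(b / N - 1, 1)]. *)
Definition grid_hit (z : 'I_M * 'I_M) (j : J) : bool :=
  let c := (z.2%:R - z.1%:R) / (2 * N%:R) in
  let m := (z.1%:R + z.2%:R) / (2 * N%:R) - 1 in
  `|X j - c * Y j - m| <= W j + `|c| * H j.

(** The predecessor does not truncate, by [grid_hit_gt0]. *)
Definition excess (z : 'I_M * 'I_M) : nat := #|grid_hit z|.-1.

Lemma grid_itv (a : 'I_M) : 0 <= (a%:R : R) / N%:R <= 2.
Proof.
have N0' : 0 < N%:R :> R by rewrite ltr0n.
rewrite divr_ge0 ?ler0n// ler_pdivrMr// -natrM ler_nat.
by have := ltn_ord a; clear; lia.
Qed.

Lemma grid_hit_gt0 z : (0 < #|grid_hit z|)%N.
Proof.
have N0' : 0 < N%:R :> R by rewrite ltr0n.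
have [h1 h2] := (grid_itv z.1, grid_itv z.2).
pose c := (z.2%:R - z.1%:R) / (2 * N%:R) : R.
pose m := (z.1%:R + z.2%:R) / (2 * N%:R) - 1 : R.
have cE : c = (z.2%:R / N%:R - z.1%:R / N%:R) / 2 by rewrite /c; field; lra.
have mE : m = (z.2%:R / N%:R + z.1%:R / N%:R) / 2 - 1 by rewrite /m; field; lra.
have c1 : `|- c| <= 1 by rewrite normrN ler_norml cE; lra.
have m1 : -1 <= m <= 1 by rewrite mE; lra.
have [|j hj] := steep_cover_itv covX c1 (t := m).
  by have := normr_ge0 (- c); lra.
apply/card_gt0P; exists j; rewrite unfold_in /grid_hit -/c -/m.
by move: hj; rewrite normrN ler_norml; lra.
Qed.

Definition shift (k : nat) : R := (k%:R - 2 * N%:R) / (2 * N%:R).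

(* The lines of a given slope meet the horizontal axis in an arithmetic
   progression of points in [[- (1 - |c|), 1 - |c|]]. *)
Lemma diagonal_count (k : 'I_(4 * N).+1) j :
  #|[pred z : 'I_M * 'I_M | (z.2 + 2 * N == z.1 + k)%N && grid_hit z j]|%:R <= 1 + N%:R *
  overlap (- (1 - `|shift k|)) (1 - `|shift k|)
    (X j - shift k * Y j - (W j + `|shift k| * H j))
    (X j - shift k * Y j + (W j + `|shift k| * H j)).
Proof.
have N0' : 0 < N%:R :> R by rewrite ltr0n.
have k0 : 0 <= (k%:R : R) <= 4 * N%:R.
  by rewrite ler0n -natrM ler_nat; have := ltn_ord k; lia.
set c := shift k.
have cN : c * (2 * N%:R) = k%:R - 2 * N%:R by rewrite divfK// gt_eqF//; lra.
have c1 : `|c| <= 1 by rewrite ler_norml ler_pdivlMr ?ler_pdivrMr; lra.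
have c0 : 0 <= `|c| := normr_ge0 c.
pose f (a : 'I_M) : R := a%:R / N%:R - 1 + c.
pose Q := [pred a : 'I_M | [exists b : 'I_M, (b + 2 * N == a + k)%N && grid_hit (a, b) j]].
have -> : #|[pred z : 'I_M * 'I_M | (z.2 + 2 * N == z.1 + k)%N && grid_hit z j]| = #|Q|.
  have hi : {in [pred z : 'I_M * 'I_M | (z.2 + 2 * N == z.1 + k)%N && grid_hit z j] &,
      injective (fun z : 'I_M * 'I_M => z.1)}.
    move=> [a b] [a' b']; rewrite !inE /= => /andP[/eqP h _] /andP[/eqP h' _] aa'.
    by subst a'; congr (_, _); apply/val_inj => /=; lia.
  rewrite -(fintype.card_in_image hi); apply: eq_card => a; rewrite inE.
  apply/fintype.imageP/existsP => [[[a' b] + ->]|[b hb]]; first by rewrite inE; exists b.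
  by exists (a, b).
have := @card_progression_le R M N%:R^-1 f Q (- (1 - `|c|)) (1 - `|c|)
    (X j - c * Y j - (W j + `|c| * H j)) (X j - c * Y j + (W j + `|c| * H j)).
rewrite invr_gt0 => /(_ N0') h.
have {}h : N%:R^-1 * (#|Q|%:R - 1) <= overlap (- (1 - `|c|)) (1 - `|c|)
    (X j - c * Y j - (W j + `|c| * H j)) (X j - c * Y j + (W j + `|c| * H j)).
  apply: h.
  - lra.
  - by have := W0 j; have := mulr_ge0 c0 (H0 j); lra.
  - by move=> a b; rewrite /f mulrBr ![N%:R^-1 * _]mulrC; lra.
  - move=> a /existsP[b /andP[/eqP hb]]; rewrite /grid_hit /=.
    have bE : b%:R = a%:R + k%:R - 2 * N%:R :> R.
      by move: hb => /(congr1 (fun n => n%:R : R)); rewrite (natrD R b) (natrD R a) natrM; lra.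
    have -> : (b%:R - a%:R) / (2 * N%:R) = c.
      by rewrite /c /shift bE; congr (_ / _); lra.
    have -> : (a%:R + b%:R) / (2 * N%:R) - 1 = f a.
      by rewrite /f /c /shift bE; field; lra.
    rewrite ler_norml => hh; split; last by lra.
    have ha := grid_itv a; have := grid_itv b.
    have -> : b%:R / N%:R = a%:R / N%:R + 2 * c.
      by rewrite /c /shift bE; field; lra.
    by rewrite /f; move: c0 ha; case: (ler0P c) => ? ? ? ?; lra.
by move: h; rewrite mulrC ler_pdivrMr// [_ * N%:R]mulrC => h; lra.
Qed.

(** The lines are grouped by slope. For each slope the shadows exceed the shadow of the square by at
    most [2 eta] in total, so no subinterval is covered by more than its length plus [2 eta]. Each
    box costs one further point on each diagonal. *)
Lemma sum_hits : (\sum_z #|grid_hit z|)%N%:R <=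
  (4 * N%:R + 1) * (2 * eta * N%:R + #|J|%:R) + (M ^ 2)%:R.
Proof.
have N0' : 0 < N%:R :> R by rewrite ltr0n.
pose diag (z : 'I_M * 'I_M) : 'I_(4 * N).+1 := inord (z.2 + 2 * N - z.1).
have diagE z k : (diag z == k) = (z.2 + 2 * N == z.1 + k)%N.
  case: z => a b; have := ltn_ord a; have := ltn_ord b; have := ltn_ord k => kN bN aN.
  rewrite -val_eqE /= inordK; [by apply/eqP/eqP => /=; lia|rewrite /=; lia].
have -> : (\sum_z #|grid_hit z|)%N%:R = \sum_(k < (4 * N).+1) \sum_j
    #|[pred z : 'I_M * 'I_M | (z.2 + 2 * N == z.1 + k)%N && grid_hit z j]|%:R :> R.
  rewrite (partition_big diag xpredT)//= natr_sum; apply: eq_bigr => k _.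
  rewrite -natr_sum; congr (_%:R).
  under eq_bigr do rewrite -sum1_card big_mkcond.
  rewrite exchange_big; apply: eq_bigr => j _.
  rewrite -sum1_card [LHS]big_mkcond [RHS]big_mkcond; apply: eq_bigr => z _.
  by rewrite diagE inE -[j \in _]/(grid_hit z j); case: (_ == _); case: grid_hit.
have diag_le (k : 'I_(4 * N).+1) : \sum_j
    #|[pred z : 'I_M * 'I_M | (z.2 + 2 * N == z.1 + k)%N && grid_hit z j]|%:R <=
    2 * eta * N%:R + #|J|%:R + (minn k (4 * N - k))%:R.
  apply: le_trans (ler_sum _ (fun j _ => diagonal_count k j)) _.
  rewrite big_split /= sumr_const -mulr_sumr.
  have k0 : 0 <= (k%:R : R) <= 4 * N%:R.
    by rewrite ler0n -natrM ler_nat -ltnS ltn_ord.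
  set c := shift k.
  have cN : c * (2 * N%:R) = k%:R - 2 * N%:R by rewrite divfK// gt_eqF//; lra.
  have c1 : `|- c| <= 1 by rewrite normrN ler_norml ler_pdivlMr ?ler_pdivrMr; lra.
  have c0 : 0 <= `|- c| := normr_ge0 _.
  have hW := sum_steep_ge W0 H0 covX (c := 0).
  have hH := sum_steep_ge H0 W0 covY (c := 0).
  have {}hW : 1 <= \sum_j W j.
    move: hW; rewrite normr0 addr0 ler01 => /(_ isT).
    by under eq_bigr do rewrite mul0r addr0.
  have {}hH : 1 <= \sum_j H j.
    move: hH; rewrite normr0 addr0 ler01 => /(_ isT).
    by under eq_bigr do rewrite mul0r addr0.
  have tot : \sum_j W j + \sum_j H j <= 2 + eta by rewrite -big_split.
  have : \sum_j overlap (- (1 - `|c|)) (1 - `|c|)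
        (X j - c * Y j - (W j + `|c| * H j)) (X j - c * Y j + (W j + `|c| * H j)) <=
      2 * (\sum_j W j + `|c| * \sum_j H j) - 2 * (1 + `|c|) + 2 * (1 - `|c|).
    rewrite mulr_sumr -big_split /= mulr_sumr.
    rewrite normrN in c1 c0.
    have := @overlap_upper R J (fun j => X j - c * Y j - (W j + `|c| * H j))
      (fun j => X j - c * Y j + (W j + `|c| * H j)) (- (1 - `|c|)) (1 - `|c|)
      (- (1 + `|c|)) (1 + `|c|).
    rewrite (_ : \sum_j (X j - c * Y j + (W j + `|c| * H j) -
      (X j - c * Y j - (W j + `|c| * H j))) = \sum_j 2 * (W j + `|c| * H j)); last first.
      by apply: eq_bigr => j _; lra.
    move=> h; apply: le_trans (h _ _ _ _ _) _; [lra|lra|lra| | |lra].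
    - by move=> j; have := W0 j; have := mulr_ge0 c0 (H0 j); lra.
    - move=> t ht; have := @steep_cover_itv _ _ _ _ (- c) t covX.
      by rewrite normrN => /(_ c1 ht) [j hj]; exists j; move: hj; rewrite mulNr.
  rewrite normrN in c1 c0.
  have kc : (minn k (4 * N - k))%:R = 2 * N%:R * (1 - `|c|) :> R.
    have k4 : (k <= 4 * N)%N by rewrite -ltnS.
    case: (leP 0 c) => hc.
      rewrite (ger0_norm hc) (minn_idPr _) ?natrB// ?natrM.
        by move: cN; rewrite mulrC; lra.
      have : 2 * N%:R <= k%:R :> R.
        by have : 0 <= c * (2 * N%:R) by [rewrite mulr_ge0//; lra]; lra.
      by rewrite -natrM ler_nat; move: k4; clear; lia.
    rewrite (ltr0_norm hc) (minn_idPl _).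
      by move: cN; rewrite mulrC; lra.
    have : k%:R <= 2 * N%:R :> R.
      by have : c * (2 * N%:R) <= 0 by [rewrite mulr_le0_ge0//; lra]; lra.
    by rewrite -natrM ler_nat; move: k4; clear; lia.
  rewrite kc.
  move: (\sum_j overlap _ _ _ _) => T hT.
  have hcH : `|c| * (\sum_j H j - 1) <= \sum_j H j - 1 by rewrite ler_piMl; lra.
  have hT' : N%:R * T <= N%:R * (2 * eta + 2 * (1 - `|c|)) by rewrite ler_pM2l; lra.
  by rewrite -mulr_natr mul1r; lra.
apply: le_trans (ler_sum _ (fun k _ => diag_le k)) _.
rewrite big_split /= sumr_const card_ord -[_ *+ (4 * N).+1]mulr_natl -natr_sum.
apply: lerD; first by rewrite -[(4 * N).+1%:R]natr1 natrM.
rewrite (_ : 4 * N = 2 * (2 * N))%N; last by rewrite mulnA.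
rewrite sum_minn.
by rewrite ler_nat leq_sqr leq_addr.
Qed.

Lemma sum_excess :
  (\sum_z excess z)%N%:R <= (4 * N%:R + 1) * (2 * eta * N%:R + #|J|%:R).
Proof.
have := sum_hits.
have -> : (\sum_z #|grid_hit z| = \sum_z excess z + M ^ 2)%N.
  have -> : (M ^ 2 = \sum_(z : 'I_M * 'I_M) 1)%N by rewrite sum1_card card_prod card_ord.
  rewrite -big_split /=.
  by apply: eq_bigr => z _; rewrite addn1 prednK// grid_hit_gt0.
by rewrite natrD; lra.
Qed.
End Grid.

(** * Rounding to the grid and the numerical constants *)

Section Product.
Variable R : realType.

Lemma card_inner_lines (N q : nat) (g x w : R) : (0 < q)%N -> 0 < g ->
  0 <= x - w -> x + w <= 2 * N%:R ->
  2 * w - 2 * g - 2 * q%:R <=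
  q%:R * #|[pred m : 'I_(2 * N + 1) | inner_line q g x w m]|%:R.
Proof.
move=> q0 g0 xw0 xw1; set c := #|_|.
have q1 : 1 <= q%:R :> R by rewrite ler1n.
have [neg|pos] := ltP (2 * w - 2 * g) 0.
  by have := mulr_ge0 (ler0n R q) (ler0n R c); lra.
pose n := Num.truncn ((2 * w - 2 * g) / q%:R).
have /andP[n1 n2] : n%:R <= (2 * w - 2 * g) / q%:R < n.+1%:R.
  by apply: Num.Theory.truncn_itv; rewrite divr_ge0// ler0n.
rewrite ler_pdivlMr in n1; last lra.
rewrite ltr_pdivrMr -?natr1 in n2; last lra.
suff : n.-1%:R <= c%:R :> R.
  have : n%:R - 1 <= n.-1%:R :> R by case: (n) => [|m] /=; rewrite ?sub0r -?natr1; lra.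
  by nra.
have q0' : 0 < q%:R :> R by lra.
have scale (t : R) : 0 <= 1 * t + - (x - w + g) / q%:R < n%:R ->
    x - w + g <= t * q%:R < x - w + g + n%:R * q%:R.
  have <- : (x - w + g) / q%:R * q%:R = x - w + g by rewrite divfK ?gt_eqF.
  rewrite -mulrDl ler_pM2r// ltr_pM2r// mul1r mulNr mulfK ?gt_eqF//.
  by lra.
rewrite ler_nat /c; apply: (@count_progression R _ n 1 (- (x - w + g) / q%:R)).
- lra.
- move=> t /scale/andP[t1 t2].
  have t0 : 0 <= t%:~R :> R by rewrite -(pmulr_lge0 _ q0'); lra.
  have tM : t%:~R < (2 * N + 1)%:Z%:~R :> R.
    rewrite -pmulrn (natrD R (2 * N) 1) natrM.
    have : t%:~R * 1 <= t%:~R * q%:R :> R by rewrite ler_wpM2l.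
    by lra.
  by move: t0 tM; rewrite ler0z ltr_int => -> ->.
- move=> m /scale/andP[t1 t2].
  by rewrite inE /inner_line natrM; lra.
Qed.

Lemma card_pairs (I : finType) M (P : I -> pred 'I_M) :
  #|[pred b : I * 'I_M | P b.1 b.2]| = (\sum_i #|[pred m | P i m]|)%N.
Proof.
rewrite -sum1_card big_mkcond /=.
under [RHS]eq_bigr do rewrite -sum1_card big_mkcond /=.
by rewrite pair_bigA.
Qed.

Lemma grid_round (N K : nat) : 1000 <= N%:R :> R -> K%:R <= 14 / 100 * N%:R :> R ->
  forall t : R, 15 / 100 * N%:R <= t <= 185 / 100 * N%:R ->
  exists2 n : 'I_(2 * N + 1), (K <= n)%N && (n + K < 2 * N + 1)%N & -1 < n%:R - t <= 0.
Proof.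
move=> hN hK t ht; have t0 : 0 <= t by lra.
have /andP[n1 n2] := Num.Theory.truncn_itv t0.
move: (Num.truncn t) n1 n2 => n n1; rewrite -natr1 => n2.
have nK : (K <= n)%N.
  by rewrite -(ler_nat R); lra.
have nM : (n + K < 2 * N + 1)%N.
  by rewrite -(ltr_nat R) natrD (natrD R (2 * N) 1) natrM; lra.
have nM' : (n < 2 * N + 1)%N by rewrite (leq_ltn_trans _ nM)// leq_addr.
by exists (Ordinal nM'); rewrite /= ?nK//; lra.
Qed.

Lemma convex_round (A a b d e : R) : 0 <= A <= 1 -> -1 < d - a <= 0 -> -1 < e - b <= 0 ->
  `|A * d + (1 - A) * e - (A * a + (1 - A) * b)| <= 1.
Proof.
move=> hA hd he; have A0 : 0 <= A by lra. have A1 : 0 <= 1 - A by lra.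
have d1 : 0 <= d - a + 1 by lra. have d2 : 0 <= a - d by lra.
have e1 : 0 <= e - b + 1 by lra. have e2 : 0 <= b - e by lra.
have := mulr_ge0 A0 d1; have := mulr_ge0 A0 d2.
have := mulr_ge0 A1 e1; have := mulr_ge0 A1 e2.
by rewrite ler_norml; lra.
Qed.

(** Cramer's rule for the crossing, relative to the centre of the grid. The factor
    [(C + 1 - A) / (A + C - 1)] is at most [10/9], and [751/1000 * 10/9 < 84/100]. *)
Lemma crossing_bound (A C u v r : R) : 19 / 20 <= A <= 1 -> 19 / 20 <= C <= 1 ->
  0 <= r -> `|u| <= 751 / 1000 * r -> `|v| <= 751 / 1000 * r ->
  `|(C * u - (1 - A) * v) / (A + C - 1)| <= 84 / 100 * r.
Proof.
move=> hA hC r0 hu hv; have d0 : 0 < A + C - 1 by lra.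
have C0 : 0 <= C by lra. have A1 : 0 <= 1 - A by lra.
rewrite normrM normfV [`|A + C - 1|]gtr0_norm// ler_pdivrMr//.
apply: le_trans (ler_normB _ _) _.
rewrite !normrM (ger0_norm C0) (ger0_norm A1).
apply: (@le_trans _ _ (C * (751 / 1000 * r) + (1 - A) * (751 / 1000 * r))).
  by apply: lerD; apply: ler_wpM2l.
have h : 0 <= 1591 / 1000 * A + 89 / 1000 * C - 1591 / 1000 by lra.
by have := mulr_ge0 r0 h; lra.
Qed.

(* The crossing of two lines, rounded to the grid. *)
Lemma grid_crossing (N K : nat) (A C x y : R) :
  19 / 20 <= A <= 1 -> 19 / 20 <= C <= 1 -> 1000 <= N%:R :> R ->
  K%:R <= 14 / 100 * N%:R :> R ->
  `|x - N%:R| <= 751 / 1000 * N%:R -> `|y - N%:R| <= 751 / 1000 * N%:R ->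
  exists z : 'I_(2 * N + 1) * 'I_(2 * N + 1),
    [/\ central K z, on_strip A x 1 z & on_strip C y 1 (swap z)].
Proof.
move=> hA hC hN hK hx hy.
pose u := x - N%:R; pose v := y - N%:R.
have := crossing_bound hC hA (ler0n R N) hy hx; rewrite -/u -/v [C + A]addrC => hr.
have := crossing_bound hA hC (ler0n R N) hx hy; rewrite -/u -/v => hp.
have rnd := grid_round hN hK.
set p := (C * u - _) / _ in hp; set r := (A * v - _) / _ in hr.
have pE : A * (N%:R + p) + (1 - A) * (N%:R + r) = x by rewrite /p /r /u /v; field; lra.
have rE : C * (N%:R + r) + (1 - C) * (N%:R + p) = y by rewrite /p /r /u /v; field; lra.
have [|a /andP[a1 a2] ha] := rnd (N%:R + p); first by move: hp; rewrite ler_norml; lra.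
have [|b /andP[b1 b2] hb] := rnd (N%:R + r); first by move: hr; rewrite ler_norml; lra.
have A01 : 0 <= A <= 1 by move: hA; clear; lra.
have C01 : 0 <= C <= 1 by move: hC; clear; lra.
exists (a, b); split; first by apply/and4P.
- by rewrite /on_strip /= -pE; exact: convex_round.
- by rewrite /on_strip /= -rE; exact: convex_round.
Qed.

(** The main term is [8 eta N^2] with [8 eta <= 0.0512]; [N] is so large that all other terms fit
    into the difference to [0.0521]. *)
Lemma excess_bound (N E n eta : R) : 0 <= n -> eta <= 4 / 625 ->
  1000 * (1000 * (n + 1)) <= N ->
  E <= (4 * N + 1) * (2 * eta * N + n) -> E <= 521 / (100 * 100) * (N * N).
Proof.
move=> n0 eta_le hN hE; have N0 : 1000 <= N by lra.
have a1 : 2 * eta * N + n <= 13 / 1000 * N.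
  have N0' : 0 <= N by lra.
  by have := ler_wpM2r N0' eta_le; lra.
have a2 : (4 * N + 1) * (2 * eta * N + n) <= (4 * N + 1) * (13 / 1000 * N).
  by apply: ler_wpM2l => //; lra.
have a3 : 1000 * N <= N * N by apply: ler_wpM2r => //; lra.
apply: le_trans hE (le_trans a2 _).
by move: N0 a3; clear; lra.
Qed.

(** The excess bounds the radius of a good window: [0.0521 < 0.23^2], and [8/7 * 0.115 < 0.14]. *)
Lemma radius_le (N K E k : nat) (n eta : R) : 0 <= n -> eta <= 4 / 625 ->
  1000 * (1000 * (n + 1)) <= N%:R :> R ->
  E%:R <= (4 * N%:R + 1) * (2 * eta * N%:R + n) :> R ->
  14 / 100 * N%:R < K%:R + 1 :> R ->
  ((2 * k + 1) ^ 2 <= E)%N -> (k + k %/ 7 <= K)%N.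
Proof.
move=> n0 eta_le hN hE hK hk.
have hE' := excess_bound n0 eta_le hN hE.
have k1 : 2 * k%:R + 1 <= 23 / 100 * N%:R :> R.
  rewrite -(@ler_pXn2r _ 2)// ?nnegrE.
  - have e : 2 * k%:R + 1 = (2 * k + 1)%:R :> R by rewrite (natrD R (2 * k) 1) natrM.
    rewrite e -natrX; apply: (@le_trans _ _ E%:R); first by rewrite ler_nat.
    apply: le_trans hE' _; have := sqr_ge0 (N%:R : R); clear; lra.
  - by rewrite addr_ge0// mulr_ge0.
  - by rewrite mulr_ge0.
rewrite -ltnS -(ltr_nat R) natrD -natr1.
have : (k %/ 7)%:R * 7 <= k%:R :> R by rewrite -natrM ler_nat leq_divM.
have := ler0n R N; move: hK k1; clear; lra.
Qed.

Lemma radius_ge (N K : nat) (n : R) : 0 <= n -> 1000 * (1000 * (n + 1)) <= N%:R :> R ->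
  14 / 100 * N%:R < K%:R + 1 :> R -> (2142 <= K)%N.
Proof. by move=> n0 hN hK; rewrite -(ler_nat R); lra. Qed.

(** A mass [m] yields about [2 N m / 50] sampled lines. The lines through all crossings give [2500 *
    4 * 64^2 * 0.0521 / 49^4 < 149/400], close to [4 m1 m2]. *)
Lemma product_arith (N c p1 p2 m1 m2 E : R) : 0 < N ->
  0 <= m1 <= 11 / 10 -> 0 <= m2 <= 11 / 10 ->
  c <= N / 200 -> 2 * N * m1 - c <= 50 * p1 -> 2 * N * m2 - c <= 50 * p2 ->
  E <= 521 / (100 * 100) * (N * N) ->
  p1 * p2 * (49 * 49) ^+ 2 <= 4 * 64 ^+ 2 * E -> m1 * m2 <= 1 / 10.
Proof.
move=> N0 m10 m20 hc l1 l2 hE hp.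
have h : p1 * p2 * 2500 <= 149 / 400 * (N * N).
  by have := sqr_ge0 N; move: (p1 * p2) hE hp => p; clear; lra.
have {}l1 : N * (2 * m1 - 1 / 200) <= 50 * p1 by move: hc l1; clear; lra.
have {}l2 : N * (2 * m2 - 1 / 200) <= 50 * p2 by move: hc l2; clear; lra.
have [s1|s1] := leP (2 * m1) (1 / 200); first by move: m10 m20 s1; clear; nra.
have [s2|s2] := leP (2 * m2) (1 / 200); first by move: m10 m20 s2; clear; nra.
have s1' : 0 <= 2 * m1 - 1 / 200 by rewrite subr_ge0 ltW.
have s2' : 0 <= 2 * m2 - 1 / 200 by rewrite subr_ge0 ltW.
have : (N * (2 * m1 - 1 / 200)) * (N * (2 * m2 - 1 / 200)) <= (50 * p1) * (50 * p2).
  exact: ler_pM (mulr_ge0 (ltW N0) s1') (mulr_ge0 (ltW N0) s2') l1 l2.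
rewrite mulrACA => l3.
have : (N * N) * ((2 * m1 - 1 / 200) * (2 * m2 - 1 / 200)) <= (N * N) * (149 / 400).
  by apply: le_trans l3 _; move: h; clear; lra.
by rewrite ler_pM2l ?mulr_gt0//; move: m10 m20; clear; lra.
Qed.
End Product.

(** * Masses near two opposite sides *)

Section Opposite.
Variables (R : realType) (J : finType) (X Y W H : J -> R) (eta : R).
Hypothesis W0 : forall j, 0 <= W j.
Hypothesis H0 : forall j, 0 <= H j.
Hypothesis covX : steep_cover X Y W H.
Hypothesis covY : steep_cover Y X H W.
Hypothesis total : \sum_j (W j + H j) <= 2 + eta.
Hypothesis Y1 : forall j, `|Y j| <= 1.
Hypothesis W1 : forall j, W j <= 1 / 1000.
Hypothesis eta_le : eta <= 4 / 625.

(** The bound on [X j] keeps the crossings of the strips, together with their windows, inside the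
    grid. *)
Definition low j := (`|X j| <= 3 / 4) && (Y j <= - (9 / 10)).
Definition high j := (`|X j| <= 3 / 4) && (9 / 10 <= Y j).

(* The boxes outside [low] get an empty strip. *)
Definition lowA j := if low j then (1 - Y j) / 2 else 1.
Definition lowW (N : nat) j := if low j then N%:R * W j else -1.
Definition highA j := if high j then (1 + Y j) / 2 else 1.
Definition highW (N : nat) j := if high j then N%:R * W j else -1.

Lemma on_strip_neg M A x (z : 'I_M * 'I_M) : on_strip A x (-1 : R) z = false.
Proof.
by apply/negbTE; rewrite /on_strip -ltNge (lt_le_trans _ (normr_ge0 _))// ltrN10.
Qed.

(** The strip uses the half-side [W j] only; the term with [H j] can only help. *)
Lemma on_strip_hit (N : nat) (z : 'I_(2 * N + 1) * 'I_(2 * N + 1)) j : (0 < N)%N ->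
  `|(1 - Y j) / 2 * z.1%:R + (1 + Y j) / 2 * z.2%:R - N%:R * (X j + 1)| <= N%:R * W j ->
  grid_hit X Y W H z j.
Proof.
move=> N0; have N0' : 0 < N%:R :> R by rewrite ltr0n.
have -> : (1 - Y j) / 2 * z.1%:R + (1 + Y j) / 2 * z.2%:R - N%:R * (X j + 1) =
    - (N%:R * (X j - (z.2%:R - z.1%:R) / (2 * N%:R) * Y j -
       ((z.1%:R + z.2%:R) / (2 * N%:R) - 1))) by field; lra.
rewrite normrN normrM gtr0_norm// ler_pM2l// => h.
by apply: le_trans h _; rewrite lerDl mulr_ge0.
Qed.

(** A box cannot be both low and high, so the strips through [z] belong to different boxes hit by
    the line. *)
Lemma low_high_le (N : nat) (z : 'I_(2 * N + 1) * 'I_(2 * N + 1)) : (0 < N)%N ->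
  (#|[pred j | on_strip (lowA j) (N%:R * (X j + 1)) (lowW N j) z]| +
   #|[pred j | on_strip (highA j) (N%:R * (X j + 1)) (highW N j) (swap z)]| <=
   (excess X Y W H z).+1)%N.
Proof.
move=> N0; rewrite /excess prednK ?(grid_hit_gt0 N0 covX)// -cardUI.
rewrite [X in (_ + X)%N]eq_card0 ?addn0; last first.
  move=> j; rewrite !inE /lowW /highW.
  case: ifP => [/andP[_ h1]|_]; last by rewrite on_strip_neg.
  case: ifP => [/andP[_ h2]|_]; last by rewrite on_strip_neg andbF.
  by lra.
apply: fintype.subset_leq_card; apply/fintype.subsetP => j; rewrite !inE.
rewrite /lowA /lowW /highA /highW.
case/orP; case: ifP => // lj; rewrite ?on_strip_neg// /on_strip /=.
- move=> h; apply: on_strip_hit => //; apply: le_trans h; rewrite le_eqVlt.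
  by apply/orP; left; apply/eqP; congr (`|_|); lra.
- move=> h; apply: on_strip_hit => //; apply: le_trans h; rewrite le_eqVlt.
  by apply/orP; left; apply/eqP; congr (`|_|); lra.
Qed.

Lemma sum_inner (N q : nat) (g : R) (P : pred J) (w := fun j => if P j then N%:R * W j else -1) :
  (0 < q)%N -> 0 < g -> 1000 <= N%:R :> R ->
  (forall j, P j -> `|X j| <= 3 / 4) ->
  2 * N%:R * (\sum_(j | P j) W j) - #|J|%:R * (2 * g + 2 * q%:R) <=
  q%:R * #|[pred b : J * 'I_(2 * N + 1) |
    inner_line q g (N%:R * (X b.1 + 1)) (w b.1) b.2]|%:R.
Proof.
move=> q0 g0 hN PX; rewrite (card_pairs (fun j m => inner_line q g (N%:R * (X j + 1)) (w j) m)).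
rewrite natr_sum [leRHS]mulr_sumr.
have -> : 2 * N%:R * (\sum_(j | P j) W j) - #|J|%:R * (2 * g + 2 * q%:R) =
    \sum_j ((if P j then 2 * N%:R * W j else 0) - (2 * g + 2 * q%:R)).
  by rewrite sumrB -big_mkcond /= -mulr_sumr sumr_const [#|J|%:R * _]mulr_natl.
apply: ler_sum => j _; have q1 : 0 < q%:R :> R by rewrite ltr0n.
rewrite /w; case: ifP => Pj; last first.
  by rewrite sub0r (@le_trans _ _ 0)// ?mulr_ge0 ?ler0n//; lra.
have := PX _ Pj; rewrite ler_norml => hX.
have [hW0 hW1] := (W0 j, W1 j).
have := @card_inner_lines R N q g (N%:R * (X j + 1)) (N%:R * W j) q0 g0.
have h1 : 0 <= N%:R * (X j + 1) - N%:R * W j by rewrite -mulrBr mulr_ge0 ?ler0n//; lra.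
have h2 : N%:R * (X j + 1) + N%:R * W j <= 2 * N%:R.
  by rewrite -mulrDr [leRHS]mulrC ler_wpM2l ?ler0n//; lra.
by move=> /(_ h1 h2); lra.
Qed.

(** The constant is [3/4] plus the largest half-side [1/1000]. *)
Lemma inner_line_itv (N q : nat) (g : R) (P : pred J) j (m : 'I_(2 * N + 1)) :
  0 <= g -> (forall j, P j -> `|X j| <= 3 / 4) ->
  inner_line q g (N%:R * (X j + 1)) (if P j then N%:R * W j else -1) m ->
  P j /\ `|(m * q)%:R - N%:R| <= 751 / 1000 * N%:R :> R.
Proof.
move=> g0 PX; rewrite /inner_line; case: ifP => Pj h; last by lra.
have := PX _ Pj; rewrite ler_norml => /andP[x1 x2]; split=> //.
have := ler_wpM2l (ler0n R N) x1; have := ler_wpM2l (ler0n R N) x2.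
have := ler_wpM2l (ler0n R N) (W1 j).
by rewrite ler_norml; lra.
Qed.

Lemma mass_itv (P : pred J) : 0 <= \sum_(j | P j) W j <= 11 / 10.
Proof.
rewrite sumr_ge0//=.
have H1 : 1 <= \sum_j H j.
  have := sum_steep_ge H0 W0 covY (c := 0); rewrite normr0 addr0 ler01 => /(_ isT).
  by under eq_bigr do rewrite mul0r addr0.
have WP : \sum_(j | P j) W j <= \sum_j W j.
  by rewrite [leRHS](bigID P) lerDl sumr_ge0.
have tot : \sum_j W j + \sum_j H j <= 2 + eta by rewrite -big_split.
apply: le_trans WP _; move: H1 tot eta_le.
by move: (\sum_j W j) (\sum_j H j) => a b; lra.
Qed.

(* In the grid of lines a box in [low] or [high] is a strip of half-width
   [N W j] with direction close to one of the two axes. The strips are sampled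
   by lines at distance [50]; the constant [2142 = 42 * 51] makes the rounding
   errors small in comparison to the windows. *)
Lemma opposite_product :
  (\sum_(j | low j) W j) * (\sum_(j | high j) W j) <= 1 / 10.
Proof.
have lowP j : low j -> `|X j| <= 3 / 4 by case/andP.
have highP j : high j -> `|X j| <= 3 / 4 by case/andP.
have cA j : 19 / 20 <= lowA j <= 1.
  rewrite /lowA; case: ifP => [/andP[_]|_]; last lra.
  by have := Y1 j; rewrite ler_norml; lra.
have cC j : 19 / 20 <= highA j <= 1.
  rewrite /highA; case: ifP => [/andP[_]|_]; last lra.
  by have := Y1 j; rewrite ler_norml; lra.
have J0 := ler0n R #|J|; have mass := mass_itv.
have [N hN] : exists N : nat, 1000 * (1000 * (#|J|%:R + 1)) <= N%:R :> R.
  by exists (Num.trunc (1000 * (1000 * (#|J|%:R + 1)) : R)).+1; apply/ltW/Num.Theory.truncnS_gt.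
have hN3 : 1000 <= N%:R :> R by lra.
have N0' : 0 < N%:R :> R by lra.
have N0 : (0 < N)%N by rewrite -(ltr_nat R).
have hJ : #|J|%:R * (2 * 2143 + 2 * 50) <= N%:R / 200 :> R by lra.
pose K := Num.truncn (14 / 100 * N%:R : R).
have N14 : 0 <= 14 / 100 * N%:R :> R by lra.
have /andP[hK1 hK2] := Num.Theory.truncn_itv N14; rewrite -/K in hK1 hK2.
rewrite -[K.+1%:R]natr1 in hK2.
have kK := radius_ge J0 hN hK2.
have hE := @sum_excess R J X Y W H eta N N0 W0 H0 covX covY total.
(* The margin [2143] is the smallest radius [2142] plus the tolerance [1] of a rounded crossing. *)
have g0 : 0 < 2143 :> R by rewrite ltr0n.
have g1 : 50%:R <= 2143 :> R by rewrite ler_nat.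
have qB := @sum_inner N 50 2143 low isT g0 hN3 lowP.
have qT := @sum_inner N 50 2143 high isT g0 hN3 highP.
have cross i (m : 'I_(2 * N + 1)) j (l : 'I_(2 * N + 1)) :
    inner_line 50 2143 (N%:R * (X i + 1)) (lowW N i) m ->
    inner_line 50 2143 (N%:R * (X j + 1)) (highW N j) l ->
    exists z : 'I_(2 * N + 1) * 'I_(2 * N + 1), [/\ central K z,
      on_strip (lowA i) (m * 50)%:R 1 z & on_strip (highA j) (l * 50)%:R 1 (swap z)].
  move=> /inner_line_itv-/(_ (ltW g0) lowP)[_ hi] /inner_line_itv-/(_ (ltW g0) highP)[_ hj].
  exact: (grid_crossing (cA i) (cC j) hN3 hK1 hi hj).
have h := @crossing_count R J J (2 * N + 1) 50 2142 K lowA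
  (fun j => N%:R * (X j + 1)) (lowW N) highA (fun j => N%:R * (X j + 1)) (highW N) 2143
  (@excess R J X Y W H N) cA cC g1 (lexx _) isT kK (fun z => low_high_le z N0)
  (fun k => radius_le J0 eta_le hN hE hK2) cross.
set p1 := (X in _ <= _ * X%:R) in qB; set p2 := (X in _ <= _ * X%:R) in qT.
have {}h : (p1 * p2 * (49 * 49) ^ 2 <= 4 * 64 ^ 2 * \sum_z excess X Y W H z)%N := h.
apply: (product_arith N0' (mass low) (mass high) hJ qB qT).
  exact: excess_bound J0 eta_le hN hE.
move: h; rewrite -(ler_nat R) (natrM _ (p1 * p2)) (natrM _ p1) natrX (natrM _ 49).
by rewrite (natrM _ (4 * 64 ^ 2)) (natrM _ 4) (natrX _ 64).
Qed.
End Opposite.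

(** * Where the boxes lie *)

Section Boxes.
Variables (R : realType) (J : finType).
Implicit Types X Y W H : J -> R.

Lemma cube_mono (s t : R) : s <= t -> s ^+ 3 <= t ^+ 3.
Proof.
move=> st; rewrite -subr_ge0.
have -> : t ^+ 3 - s ^+ 3 = (t - s) * ((t + s / 2) ^+ 2 + 3 / 4 * s ^+ 2) by field.
by rewrite mulr_ge0 ?subr_ge0// addr_ge0 ?sqr_ge0// mulr_ge0 ?sqr_ge0//; lra.
Qed.

Lemma cubic_mono (b s t : R) : - b <= s <= b -> - b <= t <= b -> s <= t ->
  3 * b ^+ 2 * s - s ^+ 3 <= 3 * b ^+ 2 * t - t ^+ 3.
Proof.
move=> hs ht st; rewrite -subr_ge0.
have -> : 3 * b ^+ 2 * t - t ^+ 3 - (3 * b ^+ 2 * s - s ^+ 3) =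
    (t - s) * ((b ^+ 2 - t ^+ 2) + (b ^+ 2 - t * s) + (b ^+ 2 - s ^+ 2)) by field.
by apply: mulr_ge0; nra.
Qed.

(* The shadow of the boxes in a diagonal direction covers [[-2, 2]], which is
   measured here with density [3 t ^+ 2]. *)
Lemma sum_cube X Y W H u : (forall j, 0 <= W j) -> (forall j, 0 <= H j) ->
  steep_cover X Y W H -> `|u| = 1 ->
  16 <= \sum_j (6 * (X j + u * Y j) ^+ 2 * (W j + H j) + 2 * (W j + H j) ^+ 3).
Proof.
move=> W0 H0 cov u1.
have : 2 ^+ 3 - (- 2) ^+ 3 <= \sum_j ((X j + u * Y j + (W j + H j)) ^+ 3 -
    (X j + u * Y j - (W j + H j)) ^+ 3).
  apply: (@cover_sum R J (fun j => X j + u * Y j - (W j + H j))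
    (fun j => X j + u * Y j + (W j + H j)) (fun t => t ^+ 3) predT predT) => //.
  - by move=> j; have := W0 j; have := H0 j; lra.
  - by move=> s t _ _; exact: cube_mono.
  - lra.
  - move=> t ht; have [||j hj] := steep_cover_itv cov (u := u) (t := t).
    + by rewrite u1.
    + by rewrite u1; lra.
    + by exists j => //; move: hj; rewrite u1 !mul1r.
rewrite (eq_bigr (fun j => 6 * (X j + u * Y j) ^+ 2 * (W j + H j) + 2 * (W j + H j) ^+ 3)).
  lra.
by move=> j _; ring.
Qed.

(* The shadow covers [[-1, 1]], measured with density [3 (b ^+ 2 - t ^+ 2)]
   which is nonnegative on the shadow. *)
Lemma sum_square X Y W H (tau : R) : 0 <= tau ->
  (forall j, 0 <= W j) -> (forall j, `|X j| <= 1) -> (forall j, W j <= tau) ->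
  steep_cover X Y W H ->
  \sum_j W j * X j ^+ 2 <= (1 + tau) ^+ 2 * (\sum_j W j - 1) + 1 / 3.
Proof.
move=> tau0 W0 X1 W1 cov; pose b := 1 + tau.
have : (3 * b ^+ 2 * 1 - 1 ^+ 3) - (3 * b ^+ 2 * (-1) - (-1) ^+ 3) <=
   \sum_j ((3 * b ^+ 2 * (X j + W j) - (X j + W j) ^+ 3) -
           (3 * b ^+ 2 * (X j - W j) - (X j - W j) ^+ 3)).
  apply: (@cover_sum R J (fun j => X j - W j) (fun j => X j + W j)
    (fun t => 3 * b ^+ 2 * t - t ^+ 3) [pred t | - b <= t <= b] predT) => //=.
  - by move=> j; have := W0 j; lra.
  - by move=> j; have := W0 j; have := W1 j; have := X1 j; rewrite ler_norml /b; lra.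
  - by move=> j; have := W0 j; have := W1 j; have := X1 j; rewrite ler_norml /b; lra.
  - by move=> s t; exact: cubic_mono.
  - by rewrite /b; lra.
  - by rewrite /b; lra.
  - move=> t ht; have [||j hj] := steep_cover_itv cov (u := 0) (t := t).
    + by rewrite normr0.
    + by rewrite normr0; lra.
    + by exists j => //; move: hj; rewrite normr0 !mul0r !addr0.
have : \sum_j ((3 * b ^+ 2 * (X j + W j) - (X j + W j) ^+ 3) -
           (3 * b ^+ 2 * (X j - W j) - (X j - W j) ^+ 3)) <=
    6 * (b ^+ 2 * \sum_j W j - \sum_j W j * X j ^+ 2).
  rewrite mulr_sumr -sumrB mulr_sumr; apply: ler_sum => j _.
  have : 0 <= W j ^+ 3 by rewrite exprn_ge0.
  by lra.
by rewrite -/b; lra.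
Qed.

Lemma depth_arith (tau eta a c p q r C : R) : 0 <= tau <= 1 / 1000 -> eta <= 4 / 625 ->
  1 <= a -> 1 <= c -> a + c <= 2 + eta ->
  p <= (1 + tau) ^+ 2 * (a - 1) + 1 / 3 -> q <= (1 + tau) ^+ 2 * (c - 1) + 1 / 3 ->
  C <= 4 * tau ^+ 2 * (2 + eta) -> 32 <= 12 * (p + q + r) + 4 * C ->
  a + c - r <= 13 / 1000.
Proof.
move=> htau heta a1 c1 tot hp hq hC h.
have t1 : (1 + tau) ^+ 2 <= 1003 / 1000 by move: htau; clear; nra.
have t2 : tau ^+ 2 <= 1 / (1000 * 1000) by move: htau; clear; nra.
have ge (s : R) : 1 <= s -> (1 + tau) ^+ 2 * (s - 1) <= 1003 / 1000 * (s - 1).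
  by move=> s1; apply: ler_wpM2r; rewrite ?subr_ge0.
have hp' := le_trans hp (lerD (ge _ a1) (lexx _)).
have hq' := le_trans hq (lerD (ge _ c1) (lexx _)).
have hC' : C <= 1 / (1000 * 100).
  by apply: le_trans hC _; have := sqr_ge0 tau; move: (tau ^+ 2) t2 heta => x; clear=> *; nra.
by move: heta tot hp' hq' hC' h; clear; lra.
Qed.

(** As [(X + Y)^2 + (X - Y)^2 = 2 X^2 + 2 Y^2], the two diagonal shadows bound the second moments
    from below by [32/12] in total, up to small terms. The axis shadows allow about [1/3] each for
    [W X^2] and [H Y^2], so [W Y^2 + H X^2] sums to almost [2], the whole mass. *)
Lemma depth_bound X Y W H (tau eta : R) :
  0 <= tau <= 1 / 1000 -> eta <= 4 / 625 ->
  (forall j, 0 <= W j) -> (forall j, 0 <= H j) ->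
  (forall j, W j <= tau) -> (forall j, H j <= tau) ->
  (forall j, `|X j| <= 1) -> (forall j, `|Y j| <= 1) ->
  steep_cover X Y W H -> steep_cover Y X H W ->
  \sum_j (W j + H j) <= 2 + eta ->
  \sum_j (W j * (1 - Y j ^+ 2) + H j * (1 - X j ^+ 2)) <= 13 / 1000.
Proof.
move=> htau heta W0 H0 W1 H1 X1 Y1 covX covY tot.
have tau0 : 0 <= tau by lra.
have c1 := sum_cube W0 H0 covX (normr1 R).
have c2 := sum_cube W0 H0 covX (etrans (normrN1 R) erefl).
have s1 := sum_square tau0 W0 X1 W1 covX.
have s2 := sum_square tau0 H0 Y1 H1 covY.
have z1 : `|0 : R| <= 1 by rewrite normr0 ler01.
have := sum_steep_ge W0 H0 covX z1; rewrite normr0 addr0.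
under eq_bigr do rewrite mul0r addr0; move=> a1.
have := sum_steep_ge H0 W0 covY z1; rewrite normr0 addr0.
under eq_bigr do rewrite mul0r addr0; move=> b1.
pose C := \sum_j (W j + H j) ^+ 3.
have C_le : C <= 4 * tau ^+ 2 * (2 + eta).
  have t2 : 0 <= 4 * tau ^+ 2 by rewrite mulr_ge0 ?sqr_ge0.
  apply: le_trans (ler_wpM2l t2 tot); rewrite mulr_sumr; apply: ler_sum => j _.
  rewrite exprSr; apply: ler_wpM2r; first by rewrite addr_ge0.
  have -> : 4 * tau ^+ 2 = (2 * tau) ^+ 2 by ring.
  by rewrite ler_pXn2r ?nnegrE ?addr_ge0 ?mulr_ge0//; have := W1 j; have := H1 j; lra.
have : 32 <= 12 * (\sum_j W j * X j ^+ 2 + \sum_j H j * Y j ^+ 2 +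
    \sum_j (W j * Y j ^+ 2 + H j * X j ^+ 2)) + 4 * C.
  have : 16 + 16 <= _ := lerD c1 c2.
  rewrite -!big_split /= !mulr_sumr -big_split /=.
  rewrite [leRHS](eq_bigr (fun j => 12 * (W j * X j ^+ 2 + H j * Y j ^+ 2 +
    (W j * Y j ^+ 2 + H j * X j ^+ 2)) + 4 * (W j + H j) ^+ 3)) => [|j _]; last by ring.
  lra.
have -> : \sum_j (W j * (1 - Y j ^+ 2) + H j * (1 - X j ^+ 2)) =
    \sum_j (W j + H j) - \sum_j (W j * Y j ^+ 2 + H j * X j ^+ 2).
  by rewrite -sumrB; apply: eq_bigr => j _; ring.
rewrite big_split /= in tot *; exact: (depth_arith htau heta a1 b1 tot s1 s2 C_le).
Qed.
End Boxes.

(** * Masses at the sides and corners, and the contradiction *)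

Section Contradiction.
Variables (R : realType) (J : finType).
Implicit Types X Y W H : J -> R.

Lemma overlap_inside (p q s t : R) : p <= s -> s <= t -> t <= q -> overlap p q s t = t - s.
Proof.
move=> ps st tq; have pq : p <= q by lra.
by rewrite /overlap /clamp !(max_idPl _) ?(min_idPl _)//; lra.
Qed.

Lemma overlap_outside (p q s t : R) : p <= q -> s <= t -> t <= p \/ q <= s ->
  overlap p q s t = 0.
Proof.
move=> pq st [tp|qs]; rewrite /overlap /clamp.
  by rewrite !(max_idPr _) ?subrr//; lra.
by rewrite !(min_idPr _) ?subrr// le_max; apply/orP; left; lra.
Qed.

Lemma steep_coverNl X Y W H : steep_cover X Y W H -> steep_cover (\- X) Y W H.
Proof.
move=> cov u t u1 t1; have [||j] := cov (- u) (- t); rewrite ?normrN// => hj.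
by exists j; rewrite -normrN; apply: le_trans hj; rewrite le_eqVlt; apply/orP; left;
  apply/eqP; congr (`|_|); rewrite /=; ring.
Qed.

Lemma steep_coverNr X Y W H : steep_cover X Y W H -> steep_cover X (\- Y) W H.
Proof.
move=> cov u t u1 t1; have [||j] := cov (- u) t; rewrite ?normrN// => hj.
by exists j; rewrite /= mulrN -mulNr.
Qed.

(** Only boxes with [|X j| <= 3/4] have a shadow reaching into the interior of [[-q, q]]. *)
Lemma central_mass X Y W H (tau : R) : 0 <= tau <= 1 / 1000 ->
  (forall j, 0 <= W j) -> (forall j, W j <= tau) -> steep_cover X Y W H ->
  3 / 4 - tau <= \sum_(j | `|X j| <= 3 / 4) W j.
Proof.
move=> htau W0 W1 cov; pose q := 3 / 4 - tau.
have q0 : - q <= q by rewrite /q; lra.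
have : q - - q <= \sum_j overlap (- q) q (X j - W j) (X j + W j).
  apply: overlap_lower => // [j|t ht]; first by have := W0 j; lra.
  have [||j hj] := steep_cover_itv cov (u := 0) (t := t).
  + by rewrite normr0.
  + by rewrite normr0; move: ht; rewrite /q; lra.
  + by exists j; move: hj; rewrite normr0 !mul0r !addr0.
have : \sum_j overlap (- q) q (X j - W j) (X j + W j) <=
    2 * \sum_(j | `|X j| <= 3 / 4) W j.
  rewrite mulr_sumr [leRHS]big_mkcond; apply: ler_sum => j _.
  have h : X j - W j <= X j + W j by have := W0 j; lra.
  case: ifP => [_|/negbT]; first by have := clamp_mono q0 h; rewrite /overlap; lra.
  rewrite -ltNge ltr_normr => hX; rewrite overlap_outside//.
  by have := W1 j; rewrite /q; case/orP: hX => hX; [right|left]; lra.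
by rewrite /q; lra.
Qed.

(* All boxes in question have their diagonal shadow within an interval of
   length [1604 / 1000], almost all of which is covered only once. *)
Lemma corner_mass X Y W H (eta : R) :
  (forall j, 0 <= W j <= 1 / 1000) -> (forall j, 0 <= H j <= 1 / 1000) ->
  (forall j, `|X j| <= 1) -> (forall j, `|Y j| <= 1) ->
  steep_cover X Y W H -> \sum_j (W j + H j) <= 2 + eta ->
  \sum_(j | low X Y j) W j + \sum_(j | low Y X j) H j <= 802 / 1000 + eta.
Proof.
move=> W0 H0 X1 Y1 cov tot.
(* One coordinate is in [[-3/4, 3/4]], the other in [[-1, -9/10]]; their sum is in [[-1.75, -0.15]],
   widened by [W + H <= 2/1000]. *)
pose p := - (1752 / 1000) : R; pose q := - (148 / 1000) : R.
have pq : p <= q by rewrite /p /q; lra.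
have uv j : X j + Y j - (W j + H j) <= X j + Y j + (W j + H j).
  by have := W0 j; have := H0 j; lra.
have : \sum_j overlap p q (X j + Y j - (W j + H j)) (X j + Y j + (W j + H j)) <=
    \sum_j ((X j + Y j + (W j + H j)) - (X j + Y j - (W j + H j))) - (2 - (- 2)) + (q - p).
  apply: overlap_upper => //; [by rewrite /p; lra|by rewrite /q; lra|].
  move=> t ht; have [||j hj] := steep_cover_itv cov (u := 1) (t := t).
  + by rewrite normr1.
  + by rewrite normr1; lra.
  + by exists j; move: hj; rewrite normr1 !mul1r.
rewrite [X in _ <= X - _ + _](eq_bigr (fun j => 2 * (W j + H j))) => [|j _]; last by lra.
rewrite -mulr_sumr => upper.
have : 2 * (\sum_(j | low X Y j) W j + \sum_(j | low Y X j) H j) <=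
    \sum_j overlap p q (X j + Y j - (W j + H j)) (X j + Y j + (W j + H j)).
  rewrite [\sum_(j | low X Y j) _]big_mkcond [\sum_(j | low Y X j) _]big_mkcond.
  rewrite -big_split /= mulr_sumr; apply: ler_sum => j _.
  have inside : low X Y j || low Y X j ->
      overlap p q (X j + Y j - (W j + H j)) (X j + Y j + (W j + H j)) = 2 * (W j + H j).
    have := W0 j; have := H0 j; have := X1 j; have := Y1 j.
    rewrite /low !ler_norml => y1 x1 h0 w0 hj.
    suff [h1 h2] : p <= X j + Y j - (W j + H j) /\ X j + Y j + (W j + H j) <= q.
      by rewrite overlap_inside ?uv//; ring.
    rewrite /p /q; move: y1 x1 h0 w0 hj; clear => ? ? ? ?.
    by case/orP => /andP[? ?]; split; lra.
  have := overlap_ge0 pq (uv j); have := W0 j; have := H0 j; move: inside.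
  move: (overlap _ _ _ _) => o; move: (low X Y j) (low Y X j) (W j) (H j) => b c w h; clear.
  by case: b; case: c => /= inside *; try have := inside isT; lra.
by move: upper tot; rewrite /p /q; lra.
Qed.

(** In each opposite pair one mass is at most [1/4]. The two others then sum to at least
    [2 * 0.499 - 0.07 = 0.928], too much for their common corner. *)
Lemma masses_arith (a b c d u v eta : R) : eta <= 4 / 625 ->
  0 <= u -> 0 <= v -> u + v <= 70 / 1000 ->
  749 / 1000 <= a + b + u -> 749 / 1000 <= c + d + v ->
  a * b <= 1 / 10 -> c * d <= 1 / 10 ->
  a + c <= 802 / 1000 + eta -> a + d <= 802 / 1000 + eta ->
  b + c <= 802 / 1000 + eta -> b + d <= 802 / 1000 + eta -> False.
Proof.
move=> heta u0 v0 uv hu hv hab hcd ac ad bc bd.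
(* If both exceeded [1/4], then [s t > (s + t) / 4 - 1/16 > 1/10]. *)
have small (s t : R) : 679 / 1000 <= s + t -> s * t <= 1 / 10 -> s <= 1 / 4 \/ t <= 1 / 4.
  move=> hst pr; case: (leP s (1 / 4)) => [|hs]; first by left.
  case: (leP t (1 / 4)) => [|ht]; first by right.
  have s0 : 0 < s - 1 / 4 by rewrite subr_gt0.
  have t0 : 0 < t - 1 / 4 by rewrite subr_gt0.
  by have := mulr_gt0 s0 t0; move: hst pr; clear; lra.
have [|ab1|ab1] := small a b _ hab; first by move: uv v0 hu; clear; lra.
all: have [|cd1|cd1] := small c d _ hcd; first by move: uv u0 hv; clear; lra.
all: by move: heta u0 v0 uv hu hv ac ad bc bd ab1 cd1; clear; lra.
Qed.

Lemma split_mass X Y W H (tau : R) : 0 <= tau <= 1 / 1000 ->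
  (forall j, 0 <= W j) -> (forall j, W j <= tau) -> steep_cover X Y W H ->
  3 / 4 - tau <= \sum_(j | low X Y j) W j + \sum_(j | high X Y j) W j +
    \sum_(j | `|Y j| < 9 / 10) W j.
Proof.
move=> htau W0 W1 cov; apply: le_trans (central_mass htau W0 W1 cov) _.
rewrite big_mkcond [X in X + _ + _]big_mkcond [X in _ + X + _]big_mkcond [X in _ + X]big_mkcond.
rewrite -!big_split /=; apply: ler_sum => j _; rewrite /low /high.
have := W0 j; case: ifP => _ /=; last by case: ifP; lra.
rewrite ltr_norml.
by case: (leP (Y j) (- (9 / 10))); case: (leP (9 / 10) (Y j)) => /=; lra.
Qed.

(** Markov's inequality with [1 - (9/10)^2 = 19/100]. *)
Lemma deep_mass Y W : (forall j, 0 <= W j) -> (forall j, `|Y j| <= 1) ->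
  19 / 100 * \sum_(j | `|Y j| < 9 / 10) W j <= \sum_j W j * (1 - Y j ^+ 2).
Proof.
move=> W0 Y1; rewrite mulr_sumr big_mkcond; apply: ler_sum => j _.
have w0 := W0 j; have := Y1 j; rewrite ler_norml => y1.
have y2 : Y j ^+ 2 <= 1 by nra.
case: ifP => [|_]; last by rewrite mulr_ge0//; lra.
rewrite ltr_norml => h; have : Y j ^+ 2 <= 81 / 100 by nra.
by move=> h2; rewrite mulrC; apply: ler_wpM2l => //; lra.
Qed.

Lemma no_small_boxes X Y W H (eta : R) : eta <= 4 / 625 ->
  (forall j, 0 <= W j <= 1 / 1000) -> (forall j, 0 <= H j <= 1 / 1000) ->
  (forall j, `|X j| <= 1) -> (forall j, `|Y j| <= 1) ->
  steep_cover X Y W H -> steep_cover Y X H W ->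
  \sum_j (W j + H j) <= 2 + eta -> False.
Proof.
move=> heta hW hH X1 Y1 covX covY tot.
have W0 j : 0 <= W j by have := hW j; lra.
have W1 j : W j <= 1 / 1000 by have := hW j; lra.
have H0 j : 0 <= H j by have := hH j; lra.
have H1 j : H j <= 1 / 1000 by have := hH j; lra.
have t0 : 0 <= (1 / 1000 : R) <= 1 / 1000 by lra.
have totC : \sum_j (H j + W j) <= 2 + eta by under eq_bigr do rewrite addrC.
(* Reflecting the second coordinate exchanges [low] and [high], reflecting the first preserves them;
   so one corner estimate serves all four corners. *)
have lowN (A B : J -> R) : low A (\- B) =1 high A B.
  by move=> j; rewrite /low /high /= lerNl opprK.
have lowNN (A B : J -> R) : low (\- A) B =1 low A B.
  by move=> j; rewrite /low /= normrN.
have X1N j : `|(\- X) j| <= 1 by rewrite /= normrN.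
have Y1N j : `|(\- Y) j| <= 1 by rewrite /= normrN.
have e1 := split_mass t0 W0 W1 covX.
have e2 := split_mass t0 H0 H1 covY.
have p1 := opposite_product W0 H0 covX covY tot Y1 W1 heta.
have p2 := opposite_product H0 W0 covY covX totC X1 H1 heta.
have c1 := corner_mass hW hH X1 Y1 covX tot.
have c2 := corner_mass hW hH X1 Y1N (steep_coverNr covX) tot.
have c3 := corner_mass hW hH X1N Y1 (steep_coverNl covX) tot.
have c4 := corner_mass hW hH X1N Y1N (steep_coverNr (steep_coverNl covX)) tot.
rewrite (eq_bigl _ _ (lowN _ _)) (eq_bigl _ _ (lowNN _ _)) in c2.
rewrite (eq_bigl _ _ (lowNN _ _)) (eq_bigl _ _ (lowN _ _)) in c3.
rewrite !(eq_bigl _ _ (lowNN _ _)) !(eq_bigl _ _ (lowN _ _)) in c4.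
have := depth_bound t0 heta W0 H0 W1 H1 X1 Y1 covX covY tot.
have := deep_mass H0 X1; have := deep_mass W0 Y1; rewrite big_split /= => d1 d2 d3.
apply: (masses_arith (u := \sum_(j | `|Y j| < 9 / 10) W j)
  (v := \sum_(j | `|X j| < 9 / 10) H j) heta _ _ _ _ _ p1 p2 c1 c3 c2 c4).
- exact: sumr_ge0.
- exact: sumr_ge0.
- by move: d1 d2 d3; clear; lra.
- by move: e1; clear; lra.
- by move: e2; clear; lra.
Qed.
End Contradiction.

(** * Total variation and length of curves *)

Section Analysis.
Variable R : realType.
Local Open Scope classical_set_scope.

Lemma within_segment_delta (f : R -> R) x (e : R) :
  {within `[0, 1], continuous f} -> 0 <= x <= 1 -> 0 < e ->
  exists N : nat, forall y, 0 <= y <= 1 -> `|y - x| < 2 / N.+1%:R -> `|f y - f x| < e.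
Proof.
move=> /subspace_continuousP cf x01 e0.
have x01' : `[0, 1]%classic x by rewrite /= in_itv.
have /cvgrPdist_lt/(_ e e0) := cf x x01'.
rewrite near_withinE => /nbhs_ballP[d /= d0 hd].
have [N hN] : exists N : nat, 2 / d < N%:R.
  by exists (Num.truncn (2 / d)).+1; exact: Num.Theory.truncnS_gt.
exists N => y y01 hy; rewrite distrC; apply: hd; last by rewrite /= in_itv.
rewrite /ball /= distrC; apply: lt_trans hy _.
rewrite ltr_pdivrMr// mulrC -ltr_pdivrMr//; apply: lt_trans hN _.
by rewrite ltr_nat.
Qed.

Lemma segment_unif_continuous (f : R -> R) (e : R) :
  {within `[0, 1], continuous f} -> 0 < e ->
  exists n : nat, forall s t, 0 <= s <= 1 -> 0 <= t <= 1 -> `|s - t| <= n.+1%:R^-1 ->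
    `|f s - f t| <= e.
Proof.
move=> cf e0; have e2 : 0 < e / 2 by lra.
(* The segment is covered by balls of half this radius, so a point near one in the ball of [x] is
   still controlled by [x]. *)
have hN x : exists N : nat, 0 <= x <= 1 -> forall y, 0 <= y <= 1 ->
    `|y - x| < 2 / N.+1%:R -> `|f y - f x| < e / 2.
  have [x01|x01] := boolP (0 <= x <= 1); last by exists 0%N.
  by have [N h] := within_segment_delta cf x01 e2; exists N.
have /choice[N {}hN] := hN.
have := @segment_compact R 0 1; rewrite compact_cover.
move=> /(_ R `[0, 1] (fun x => ball x (N x).+1%:R^-1)) [| |D D01 Dcov].
- by move=> x _; apply: ball_open; rewrite invr_gt0.
- by move=> x x01; exists x => //; apply: ballxx; rewrite invr_gt0.
exists (\max_(x <- finmap.enum_fset D) N x)%N => s t s01 t01 st.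
have [|x Dx xs] := Dcov s; first by rewrite /= in_itv.
have x01 : 0 <= x <= 1.
  by have /set_mem := D01 _ Dx; rewrite /= in_itv.
have st' : `|s - t| <= (N x).+1%:R^-1.
  apply: le_trans st _; rewrite lef_pV2 ?posrE// ler_nat ltnS.
  by rewrite (big_rem x)//= leq_maxl.
have xs' : `|x - s| < (N x).+1%:R^-1 by exact: xs.
have h1 := hN x x01 s s01; have h2 := hN x x01 t t01.
have r0 : 0 < (N x).+1%:R^-1 :> R by rewrite invr_gt0.
have rr : (N x).+1%:R^-1 < 2 / (N x).+1%:R :> R by rewrite ltr_pMl// ltr1n.
have a1 : `|s - x| < 2 / (N x).+1%:R by rewrite distrC; exact: lt_trans xs' rr.
have a2 : `|t - x| < 2 / (N x).+1%:R.
  rewrite distrC in xs'; rewrite distrC in st'.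
  apply: le_lt_trans (ler_distD s t x) _; rewrite mulr_natl mulr2n.
  exact: ler_ltD.
have := ler_distD (f x) (f s) (f t); rewrite [`|f x - f t|]distrC.
by have := h1 a1; have := h2 a2; lra.
Qed.

(** Real-valued total variation; an infinite one becomes [0], so lemmas that need it carry
    finiteness. *)
Definition rtv (a b : R) (f : R -> R) : R := fine (TV a b f).

Lemma TV_le (a b c : R) (f : R -> R) :
  (forall s, itv_partition a b s -> variation a b f s <= c) -> (TV a b f <= c%:E)%E.
Proof.
move=> h; apply: ge_ereal_sup => _ [_ [s hs <-] <-].
by rewrite lee_fin; exact: h.
Qed.

Lemma TV_fin (a b c : R) (f : R -> R) : a <= b -> (TV a b f <= c%:E)%E ->
  TV a b f \is a fin_num.
Proof.
move=> ab h; rewrite ge0_fin_numE ?total_variation_ge0//.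
by apply: le_lt_trans h _; rewrite ltry.
Qed.

Lemma TV_finS (a b c d : R) (f : R -> R) : a <= c -> c <= d -> d <= b ->
  TV a b f \is a fin_num -> TV c d f \is a fin_num.
Proof.
move=> ac cd db; have cb := le_trans cd db.
rewrite (total_variationD f ac cb) (total_variationD f cd db).
rewrite fin_numD => /andP[_]; rewrite fin_numD => /andP[]//.
Qed.

Lemma rtvD (a b c : R) (f : R -> R) : a <= c -> c <= b -> TV a b f \is a fin_num ->
  rtv a b f = rtv a c f + rtv c b f.
Proof.
move=> ac cb fin; rewrite /rtv (total_variationD f ac cb) fineD//.
  exact: TV_finS fin.
exact: TV_finS fin.
Qed.

Lemma rtv_ge0 (a b : R) (f : R -> R) : a <= b -> 0 <= rtv a b f.
Proof. by move=> ab; rewrite fine_ge0// total_variation_ge0. Qed.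

Lemma dist_le_rtv (a b s t : R) (f : R -> R) : TV a b f \is a fin_num ->
  a <= s <= b -> a <= t <= b -> `|f s - f t| <= rtv a b f.
Proof.
move=> fin; wlog st : s t / t <= s => [th sab tab|].
  have [ts|st] := leP t s; first exact: th.
  by rewrite distrC; apply: th => //; exact: ltW.
move=> /andP[sa sb] /andP[ta tb].
rewrite (rtvD ta tb fin) (rtvD st sb) ?(TV_finS _ _ _ fin)//.
have h1 := rtv_ge0 f ta; have h2 := rtv_ge0 f sb.
have : `|f s - f t| <= rtv t s f.
  rewrite -lee_fin /rtv fineK ?(TV_finS _ _ _ fin)//.
  exact: total_variation_ge.
lra.
Qed.

Lemma sum_rtv (f : R -> R) (n : nat) : TV 0 1 f \is a fin_num ->
  \sum_(k < n.+1) rtv (k%:R / n.+1%:R) (k.+1%:R / n.+1%:R) f = rtv 0 1 f.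
Proof.
move=> fin; have n0 : 0 < n.+1%:R :> R by rewrite ltr0n.
suff h m : (m <= n.+1)%N ->
    \sum_(k < m) rtv (k%:R / n.+1%:R) (k.+1%:R / n.+1%:R) f = rtv 0 (m%:R / n.+1%:R) f.
  by rewrite h// divff// gt_eqF.
elim: m => [_|m IH mn]; first by rewrite big_ord0 mul0r /rtv total_variationxx.
rewrite big_ord_recr /= IH ?(ltnW mn)// -rtvD//.
- by rewrite ler_pM2r ?invr_gt0// ler_nat.
- apply: TV_finS fin => //.
  by rewrite ler_pdivrMr// mul1r ler_nat.
Qed.
End Analysis.

(** * Variations in four directions and the length *)

Section Partitions.
Variable R : realType.

Lemma itv_partition_mem (s : seq R) : itv_partition 0 1 s ->
  [/\ sorted <%R s, forall x, x \in s -> 0 < x <= 1 & 1 \in s].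
Proof.
case=> ps /eqP ls; have s1 : 1 \in s.
  have : last 0 s \in 0 :: s by exact: mem_last.
  by rewrite ls inE oner_eq0.
split=> // [|x xs]; first exact: path_sorted ps.
move: (ps); rewrite lt_path_sortedE => /andP[/allP/(_ x xs) -> _] /=.
have := xs => /(nthP 1)[i si <-].
by apply: (@itv_partition_nth_le _ _ 0 1 s i.+1) => //; split; rewrite ?ls.
Qed.

Lemma itv_partition_of_mem (s : seq R) : sorted <%R s ->
  (forall x, x \in s -> 0 < x <= 1) -> 1 \in s -> itv_partition 0 1 s.
Proof.
move=> ss s01 s1; have ps : path <%R 0 s.
  by rewrite lt_path_sortedE ss andbT; apply/allP => x /s01/andP[].
split=> //; case/lastP: s ss s01 s1 ps => // s z ss s01 s1 ps.
rewrite last_rcons eq_le.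
have /andP[_ ->] : 0 < z <= 1 by apply: s01; rewrite mem_rcons mem_head.
move: s1; rewrite mem_rcons inE => /predU1P[<-|s1]; first by rewrite lexx.
move: ss; rewrite (sorted_pairwise lt_trans) pairwise_rcons => /andP[/allP/(_ _ s1)/ltW -> _].
by [].
Qed.

(** Partitions are the strictly sorted sequences in []0, 1]] that contain [1], so the sorted union
    of two is again one. *)
Lemma common_refinement (s t : seq R) : itv_partition 0 1 s -> itv_partition 0 1 t ->
  exists r, [/\ itv_partition 0 1 r, subseq s r & subseq t r].
Proof.
move=> /itv_partition_mem[ss s01 s1] /itv_partition_mem[tt t01 t1].
pose r := sort <=%R (undup (s ++ t)).
have rr : sorted <%R r by rewrite sort_lt_sorted undup_uniq.
have rE x : (x \in r) = (x \in s) || (x \in t) by rewrite mem_sort mem_undup mem_cat.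
have sub u : sorted <%R u -> {subset u <= r} -> subseq u r.
  move=> uu ur; suff -> : u = [seq x <- r | x \in u] by exact: filter_subseq.
  apply: lt_sorted_eq => //; first exact: (sorted_filter lt_trans).
  by move=> x; rewrite mem_filter; apply/idP/andP => [xu|[]//]; rewrite ur.
exists r; split.
- apply: itv_partition_of_mem => //; last by rewrite rE s1.
  by move=> x; rewrite rE => /orP[/s01|/t01].
- by apply: sub => // x xs; rewrite rE xs.
- by apply: sub => // x xt; rewrite rE xt orbT.
Qed.

(* Up to symmetry the left-hand side is [300 u + v] with [0 <= v <= u], at most
   [sqrt (300 ^ 2 + 1) <= 300 + 1 / 600] times the norm by Cauchy-Schwarz. *)
Lemma edge_bound (u v l : R) : 0 <= l -> l ^+ 2 = u ^+ 2 + v ^+ 2 ->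
  `|u| + `|v| + 299 / 2 * (`|u + v| + `|u - v|) <= (300 + 1 / 600) * l.
Proof.
move=> l0 hl.
have key (a b : R) : 0 <= b <= a -> a ^+ 2 + b ^+ 2 = l ^+ 2 ->
    300 * a + b <= (300 + 1 / 600) * l.
  move=> hab h; rewrite -(@ler_pXn2r _ 2)// ?nnegrE; [|lra|lra].
  (* [(300 a + b)^2 + (a - 300 b)^2 = (300^2 + 1) (a^2 + b^2)]. *)
  have : 0 <= (a - 300 * b) ^+ 2 := sqr_ge0 _.
  by rewrite exprMn -h; nra.
have u2 := real_normK (num_real u); have v2 := real_normK (num_real v).
have -> : `|u + v| + `|u - v| = 2 * Num.max `|u| `|v|.
  clear; case: (ler0P u) => hu; case: (ler0P v) => hv; case: (ler0P (u + v)) => huv;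
  case: (ler0P (u - v)) => huv'; case: leP => h; lra.
case: (leP `|u| `|v|) => huv.
  have := key `|v| `|u|; rewrite normr_ge0 huv u2 v2 hl addrC => /(_ isT erefl).
  by lra.
have := key `|u| `|v|; rewrite normr_ge0 (ltW huv) u2 v2 hl => /(_ isT erefl).
by lra.
Qed.
End Partitions.

Section Length.
Variable R : realType.
Lemma rtv_le (a b c : R) (f : R -> R) : a <= b ->
  (forall s, itv_partition a b s -> variation a b f s <= c) -> rtv a b f <= c.
Proof.
move=> ab h; have hc := TV_le h; rewrite -lee_fin /rtv fineK//.
exact: TV_fin ab hc.
Qed.

Variable g : R -> R * R.
Hypothesis hg : rectifiable_curve g.
Let x s := (g s).1.
Let y s := (g s).2.
Let p s := x s + y s.
Let m s := x s - y s.
Let L := fine (curve_length g).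

Lemma curve_length_ge0 : (0 <= curve_length g)%E.
Proof.
apply: (@le_trans _ _ (polygon_length 0 1 g [:: 1])%:E).
  by rewrite lee_fin; apply: sumr_ge0 => n _; exact: sqrtr_ge0.
by apply: ereal_sup_ubound; exists [:: 1] => //; exact: itv_partition1.
Qed.

Lemma curve_length_fin : curve_length g \is a fin_num.
Proof. by rewrite ge0_fin_numE ?curve_length_ge0//; case: hg. Qed.

Lemma variation_length (s : seq R) : itv_partition 0 1 s ->
  variation 0 1 x s + variation 0 1 y s +
    299 / 2 * (variation 0 1 p s + variation 0 1 m s) <= (300 + 1 / 600) * L.
Proof.
move=> hs; apply: (@le_trans _ _ ((300 + 1 / 600) * polygon_length 0 1 g s)); last first.
  apply: ler_wpM2l; first lra.
  rewrite -lee_fin /L fineK ?curve_length_fin//.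
  by apply: ereal_sup_ubound; exists s.
rewrite /variation /polygon_length -!big_split /= mulr_sumr -big_split /= mulr_sumr.
apply: ler_sum => n _; set P := g _; set Q := g _.
rewrite /x /y /p /m /x /y -/P -/Q.
have := @edge_bound R (P.1 - Q.1) (P.2 - Q.2) (eucl_dist P Q).
have -> : P.1 - Q.1 + (P.2 - Q.2) = P.1 + P.2 - (Q.1 + Q.2) by ring.
have -> : P.1 - Q.1 - (P.2 - Q.2) = P.1 - P.2 - (Q.1 - Q.2) by ring.
by apply; rewrite ?sqrtr_ge0// sqr_sqrtr// addr_ge0 ?sqr_ge0.
Qed.

(** Refining increases variations; independent partitions allow the four suprema to be taken one
    after another in [rtv_length]. *)
Lemma variations_length (s1 s2 s3 s4 : seq R) : itv_partition 0 1 s1 ->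
  itv_partition 0 1 s2 -> itv_partition 0 1 s3 -> itv_partition 0 1 s4 ->
  variation 0 1 x s1 + variation 0 1 y s2 +
    299 / 2 * (variation 0 1 p s3 + variation 0 1 m s4) <= (300 + 1 / 600) * L.
Proof.
move=> h1 h2 h3 h4.
have [r1 [hr1 s1r s2r]] := common_refinement h1 h2.
have [r2 [hr2 s3r s4r]] := common_refinement h3 h4.
have [r [hr r1r r2r]] := common_refinement hr1 hr2.
apply: le_trans (variation_length hr).
have v1 := variation_subseq x h1 hr (subseq_trans s1r r1r).
have v2 := variation_subseq y h2 hr (subseq_trans s2r r1r).
have v3 := variation_subseq p h3 hr (subseq_trans s3r r2r).
have v4 := variation_subseq m h4 hr (subseq_trans s4r r2r).
by lra.
Qed.

Lemma TV_curve_fin : [/\ TV 0 1 x \is a fin_num, TV 0 1 y \is a fin_num,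
  TV 0 1 p \is a fin_num & TV 0 1 m \is a fin_num].
Proof.
have h s (hs : itv_partition 0 1 s) := variation_length hs.
have fin (f : R -> R) c : (forall s, itv_partition 0 1 s -> variation 0 1 f s <= c) ->
    TV 0 1 f \is a fin_num by move=> /TV_le; exact: TV_fin.
have v0 f s : 0 <= variation (0 : R) 1 f s by exact: variation_ge0.
split; apply: (fin _ ((300 + 1 / 600) * L)) => s /h;
  have := v0 x s; have := v0 y s; have := v0 p s; have := v0 m s; lra.
Qed.

Lemma rtv_length :
  rtv 0 1 x + rtv 0 1 y + 299 / 2 * (rtv 0 1 p + rtv 0 1 m) <= (300 + 1 / 600) * L.
Proof.
pose A := (300 + 1 / 600) * L.
have r1 s2 s3 s4 : itv_partition 0 1 s2 -> itv_partition 0 1 s3 -> itv_partition 0 1 s4 ->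
    rtv 0 1 x <= A - variation 0 1 y s2 - 299 / 2 * (variation 0 1 p s3 + variation 0 1 m s4).
  move=> h2 h3 h4; apply: rtv_le => // s1 h1.
  by have := variations_length h1 h2 h3 h4; rewrite -/A; lra.
have r2 s3 s4 : itv_partition 0 1 s3 -> itv_partition 0 1 s4 ->
    rtv 0 1 y <= A - rtv 0 1 x - 299 / 2 * (variation 0 1 p s3 + variation 0 1 m s4).
  by move=> h3 h4; apply: rtv_le => // s2 h2; have := r1 _ _ _ h2 h3 h4; lra.
have r3 s4 : itv_partition 0 1 s4 ->
    rtv 0 1 p <= 2 / 299 * (A - rtv 0 1 x - rtv 0 1 y) - variation 0 1 m s4.
  by move=> h4; apply: rtv_le => // s3 h3; have := r2 _ _ h3 h4; lra.
have r4 : rtv 0 1 m <= 2 / 299 * (A - rtv 0 1 x - rtv 0 1 y) - rtv 0 1 p.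
  by apply: rtv_le => // s4 h4; have := r3 _ h4; lra.
by rewrite -/A; lra.
Qed.
End Length.

(** * Small boxes around the pieces of a curve *)

Section CurveBoxes.
Variable R : realType.
Local Open Scope classical_set_scope.
(** [s] and [t] are a maximum and a minimum point; doubling avoids halves for the centre and radius
    of the range. *)
Lemma extremes (f : R -> R) (a b : R) : a <= b -> {within `[a, b], continuous f} ->
  exists s t, [/\ a <= s <= b, a <= t <= b &
    forall r, a <= r <= b -> `|2 * f r - (f s + f t)| <= `|f s - f t|].
Proof.
move=> ab cf; have [s sab smax] := EVT_max ab cf; have [t tab tmin] := EVT_min ab cf.
exists s, t; split; [by move: sab; rewrite in_itv|by move: tab; rewrite in_itv|].
move=> r rab; have := smax r; have := tmin r; rewrite in_itv/= rab => /(_ isT) h1 /(_ isT) h2.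
by rewrite ler_norml ger0_norm; lra.
Qed.

Record boxes := Boxes { bnum : nat; bX : nat -> R; bY : nat -> R; bW : nat -> R; bH : nat -> R }.

(* The doubled coordinates [2 x - 1] map the unit square onto [[-1, 1]^2]. *)
Definition boxes_of (g : R -> R * R) (tau : R) (b : boxes) := [/\
  forall k, [/\ `|bX b k| <= 1, `|bY b k| <= 1, 0 <= bW b k <= tau & 0 <= bH b k <= tau],
  forall s, 0 <= s <= 1 -> exists k : 'I_(bnum b), `|2 * (g s).1 - 1 - bX b k| <= bW b k /\
    `|2 * (g s).2 - 1 - bY b k| <= bH b k &
  \sum_(k < bnum b) (bW b k + bH b k) <=
    rtv 0 1 (fun s => (g s).1) + rtv 0 1 (fun s => (g s).2)].

Lemma grid_cell (n : nat) (s : R) : 0 <= s <= 1 ->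
  exists k : 'I_n.+1, k%:R / n.+1%:R <= s <= k.+1%:R / n.+1%:R.
Proof.
move=> /andP[s0 s1]; have n0 : 0 < n.+1%:R :> R by rewrite ltr0n.
have sn0 : 0 <= s * n.+1%:R by rewrite mulr_ge0.
have /andP[k1 k2] := Num.Theory.truncn_itv sn0.
have [kn|kn] := leqP (Num.truncn (s * n.+1%:R)) n.
  exists (Ordinal (kn : (Num.truncn (s * n.+1%:R) < n.+1)%N)) => /=.
  by rewrite ler_pdivrMr// ler_pdivlMr// k1 ltW.
(* Only [s = 1] gets here; it belongs to the last cell. *)
exists ord_max; rewrite /= divff ?gt_eqF// s1 andbT ler_pdivrMr//.
by apply: le_trans k1; rewrite ler_nat ltnW.
Qed.

Lemma piece_extremes (f : R -> R) (n : nat) (tau : R) :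
  {within `[0, 1], continuous f} -> TV 0 1 f \is a fin_num ->
  (forall s t, 0 <= s <= 1 -> 0 <= t <= 1 -> `|s - t| <= n.+1%:R^-1 -> `|f s - f t| <= tau) ->
  exists c w : nat -> R,
    [/\ forall k, exists s t, [/\ 0 <= s <= 1, 0 <= t <= 1 & c k = f s + f t],
      forall k, 0 <= w k <= tau,
      forall (k : 'I_n.+1) r, k%:R / n.+1%:R <= r <= k.+1%:R / n.+1%:R -> `|2 * f r - c k| <= w k &
      \sum_(k < n.+1) w k <= rtv 0 1 f].
Proof.
move=> cf fin hn; have n0 : 0 < n.+1%:R :> R by rewrite ltr0n.
pose a k : R := k%:R / n.+1%:R.
have a01 (k : 'I_n.+1) : [/\ 0 <= a k, a k <= a k.+1 & a k.+1 <= 1].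
  split; first by rewrite divr_ge0.
    by rewrite ler_pM2r ?invr_gt0// ler_nat.
  by rewrite ler_pdivrMr// mul1r ler_nat.
have cell k : exists st : R * R, [/\ 0 <= st.1 <= 1, 0 <= st.2 <= 1,
    `|f st.1 - f st.2| <= tau & (k < n.+1)%N ->
    `|f st.1 - f st.2| <= rtv (a k) (a k.+1) f /\
    forall r, a k <= r <= a k.+1 -> `|2 * f r - (f st.1 + f st.2)| <= `|f st.1 - f st.2|].
  (* Indices beyond the last piece get the default [(0, 0)] of width [0]. *)
  have [kn|kn] := ltnP k n.+1; last first.
    exists (0, 0); rewrite /= subrr normr0 lexx ler01; split=> //.
    have := hn 0 0; rewrite !subrr normr0 lexx ler01 invr_ge0 ler0n.
    exact.
  have [k0 kk k1] := a01 (Ordinal kn).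
  have [|s [t [sk tk hst]]] := @extremes f (a k) (a k.+1) kk.
    apply: continuous_subspaceW cf => r /=; rewrite !in_itv /= => /andP[r1 r2].
    by rewrite (le_trans k0 r1) (le_trans r2 k1).
  have s01 : 0 <= s <= 1 by move: sk; move: k0 k1 => /=; lra.
  have t01 : 0 <= t <= 1 by move: tk; move: k0 k1 => /=; lra.
  exists (s, t); split=> //=.
    apply: hn => //; have e : a k.+1 - a k = n.+1%:R^-1.
      by rewrite /a -mulrBl -natrB// subSnn mul1r.
    rewrite -e; move: (a k) (a k.+1) sk tk => u v sk tk.
    by rewrite ler_norml; lra.
  move=> _; split=> //; apply: dist_le_rtv => //.
  exact: TV_finS fin.
have /choice[st hst] := cell.
exists (fun k => f (st k).1 + f (st k).2), (fun k => `|f (st k).1 - f (st k).2|); split.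
- by move=> k; exists (st k).1, (st k).2; have [] := hst k.
- by move=> k; rewrite normr_ge0; have [] := hst k.
- by move=> k r hr; have [_ _ _ /(_ (ltn_ord k))[_]] := hst k; exact.
- rewrite -(sum_rtv n fin); apply: ler_sum => k _.
  by have [_ _ _ /(_ (ltn_ord k))[]] := hst k.
Qed.

Lemma curve_continuous (g : R -> R * R) : {within `[0, 1], continuous g} ->
  {within `[0, 1], continuous (fun s => (g s).1)} /\
  {within `[0, 1], continuous (fun s => (g s).2)}.
Proof.
move=> /subspace_continuousP cg; split; apply/subspace_continuousP => s s01.
  by apply: cvg_comp (cg s s01) _; exact: cvg_fst.
by apply: cvg_comp (cg s s01) _; exact: cvg_snd.
Qed.

Lemma curve_boxes (g : R -> R * R) (tau : R) : rectifiable_curve g -> 0 < tau ->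
  (forall s, 0 <= s <= 1 -> 0 <= (g s).1 <= 1 /\ 0 <= (g s).2 <= 1) ->
  exists b, boxes_of g tau b.
Proof.
move=> hg tau0 gU; have [cx cy] := curve_continuous hg.1.
have [n1 u1] := segment_unif_continuous cx tau0.
have [n2 u2] := segment_unif_continuous cy tau0.
have [fx fy _ _] := TV_curve_fin hg.
pose n := maxn n1 n2.
have nle m : (m <= n)%N -> n.+1%:R^-1 <= m.+1%:R^-1 :> R.
  by move=> mn; rewrite lef_pV2 ?posrE// ler_nat ltnS.
have [|cX [wX [X1 X2 X3 X4]]] := @piece_extremes _ n tau cx fx.
  by move=> s t s01 t01 st; apply: u1 => //; apply: le_trans st (nle _ (leq_maxl _ _)).
have [|cY [wY [Y1 Y2 Y3 Y4]]] := @piece_extremes _ n tau cy fy.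
  by move=> s t s01 t01 st; apply: u2 => //; apply: le_trans st (nle _ (leq_maxr _ _)).
exists (Boxes n.+1 (fun k => cX k - 1) (fun k => cY k - 1) wX wY); split=> /=.
- move=> k; have [s [t [s01 t01 ->]]] := X1 k; have [s' [t' [s01' t01' ->]]] := Y1 k.
  have [h1 h2] := (gU s s01, gU t t01); have [h3 h4] := (gU s' s01', gU t' t01').
  by split=> //; rewrite ler_norml; move: h1 h2 h3 h4; clear=> -[? ?] [? ?] [? ?] [? ?]; lra.
- move=> s s01; have [k hk] := grid_cell n s01; exists k.
  rewrite !opprB !addrA !subrK /=.
  by split; [exact: X3|exact: Y3].
- by rewrite big_split /=; apply: lerD.
Qed.
End CurveBoxes.

(** * From the barrier to boxes *)

(* The library has no [ptopologicalType] instance on products. *)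
HB.saturate prod.

Section Blockers.
Variable R : realType.
Local Open Scope classical_set_scope.

Lemma open_near_line (x y r : R) :
  open [set z : R * R | `|x + z.1 * y - z.2 * (1 + `|z.1|)| < r * (1 + `|z.1|)].
Proof.
pose F (z : R * R) := `|x + z.1 * y - z.2 * (1 + `|z.1|)| - r * (1 + `|z.1|).
have cF : continuous F.
  move=> z; have c1 : {for z, continuous (fst : R * R -> R)} by exact: cvg_fst.
  have c2 : {for z, continuous (snd : R * R -> R)} by exact: cvg_snd.
  have c3 : {for z, continuous (fun z : R * R => 1 + `|z.1|)}.
    apply: cvgD; first exact: cvg_cst.
    exact: cvg_norm.
  apply: cvgB; last by apply: cvgM => //; exact: cvg_cst.
  apply: cvg_norm; apply: cvgB; last exact: cvgM.
  by apply: cvgD; [exact: cvg_cst|apply: cvgM => //; exact: cvg_cst].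
have -> : [set z : R * R | `|x + z.1 * y - z.2 * (1 + `|z.1|)| < r * (1 + `|z.1|)] =
    F @^-1` [set t | t < 0].
  by apply/seteqP; split=> z /=; rewrite /F subr_lt0.
by apply: open_comp; [move=> z _; exact: cF|exact: open_lt].
Qed.

(** Lines passing within [r i] of the [i]-th curve form an open set of parameters [(u, t)];
    compactness leaves finitely many curves. The factor [1 + |u|] makes [r i] an enlargement of both
    half-sides of a box. *)
Lemma finite_blockers (D : set nat) (x y : nat -> R -> R) (r : nat -> R) :
  (forall i, 0 < r i) ->
  (forall u t, `|u| <= 1 -> `|t| <= 1 -> exists i s, [/\ D i, 0 <= s <= 1 &
     x i s + u * y i s = t * (1 + `|u|)]) ->
  exists K : nat, forall u t, `|u| <= 1 -> `|t| <= 1 -> exists i s,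
    [/\ (i < K)%N, D i, 0 <= s <= 1 &
     `|x i s + u * y i s - t * (1 + `|u|)| < r i * (1 + `|u|)].
Proof.
move=> r0 block.
have := compact_setX (@segment_compact R (-1) 1) (@segment_compact R (-1) 1).
rewrite compact_cover => /(_ nat D (fun i => \bigcup_(s in `[0, 1]%classic)
  [set z : R * R | `|x i s + z.1 * y i s - z.2 * (1 + `|z.1|)| < r i * (1 + `|z.1|)])).
case=> [i _|[u t] [/= u1 t1]|F FD Fcov].
- by apply: bigcup_open => s _; exact: open_near_line.
- rewrite !in_itv /= -!ler_norml in u1 t1.
  have [i [s [Di s01 e]]] := block u t u1 t1.
  exists i => //; exists s; first by rewrite /= in_itv.
  by rewrite /= e subrr normr0 mulr_gt0// ltr_pwDl.
exists (\max_(i <- finmap.enum_fset F) i).+1 => u t u1 t1.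
have [|i Fi [s s01 h]] := Fcov (u, t).
  by split; rewrite /= in_itv /= -ler_norml.
exists i, s; split=> //.
- by rewrite ltnS (big_rem i)//= leq_maxl.
- by have /set_mem := FD _ Fi.
Qed.
End Blockers.

(** * Lines blocked by the barrier, shadows and lengths *)

Section Barrier.
Variable R : realType.
Local Open Scope classical_set_scope.
Lemma scaled_line_blocked (D : set nat) (gamma : nat -> R -> R * R) :
  interior_barrier (unit_square R) (curves_union D gamma) ->
  forall a b t, (a, b) != (0, 0) -> `|t| <= 1 -> exists i s, [/\ D i, 0 <= s <= 1 &
    a * (2 * (gamma i s).1 - 1) + b * (2 * (gamma i s).2 - 1) = t * (`|a| + `|b|)].
Proof.
move=> [bar _] a b t ab0 t1.
pose c := (t * (`|a| + `|b|) + a + b) / 2.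
have lineE : is_line [set q | a * q.1 + b * q.2 = c] by exists a, b, c.
have [|z [lz [i Di [s s01 gz]]]] := bar _ lineE.
  have sg1 (z : R) : `|t * Num.sg z| <= 1.
    by rewrite normrM normr_sg; case: (z != 0); rewrite ?mulr1 ?mulr0 ?ler01.
  (* In doubled coordinates this is the point [t (sg a, sg b)] of the square, which lies on the
     line. *)
  exists ((1 + t * Num.sg a) / 2, (1 + t * Num.sg b) / 2); split.
    by rewrite /= /c (normrEsg a) (normrEsg b); field.
  have := sg1 a; have := sg1 b; rewrite !ler_norml.
  move: (t * Num.sg a) (t * Num.sg b) => v w ? ?.
  by split; rewrite /= in_itv /=; lra.
exists i, s; split=> //.
by move: lz; rewrite -gz /= /c; lra.
Qed.

(** The shadow of each curve lies in an interval of radius [v i]; enlarged by [2 r i], these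
    intervals cover [[d - 2, d + 2]]. *)
Lemma shadow_sum (K : nat) (P : pred 'I_K) (q : 'I_K -> R -> R) (d : R) (v r : 'I_K -> R) :
  (forall i, 0 <= v i) -> (forall i, 0 <= r i) ->
  (forall i, P i -> exists c, forall s, 0 <= s <= 1 -> `|2 * q i s - c| <= v i) ->
  (forall t, `|t| <= 1 -> exists i s,
     [/\ P i, 0 <= s <= 1 & `|2 * q i s - d - 2 * t| <= 2 * r i]) ->
  2 <= \sum_(i | P i) v i + 2 * \sum_(i | P i) r i.
Proof.
move=> v0 r0 ex cov.
have /choice[c hc] i : exists c, P i -> forall s, 0 <= s <= 1 -> `|2 * q i s - c| <= v i.
  by have [/ex[z hz]|] := boolP (P i); [exists z|exists 0].
have := @cover_sum _ _ (fun i => c i - v i - 2 * r i) (fun i => c i + v i + 2 * r i) id predT P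
  (d - 2) (d + 2).
have -> : \sum_(i | P i) (id (c i + v i + 2 * r i) - id (c i - v i - 2 * r i)) =
    2 * (\sum_(i | P i) v i + 2 * \sum_(i | P i) r i).
  rewrite mulr_sumr -big_split/= mulr_sumr; apply: eq_bigr => i _.
  by ring.
rewrite /=; move: (\sum_(i | P i) v i + _) => S h.
suff : d + 2 - (d - 2) <= 2 * S by clear; lra.
apply: h => //; first by move=> i; have := v0 i; have := r0 i; clear; lra.
  by clear; lra.
move=> t ht; have [|i [s [Pi s01 h]]] := cov ((t - d) / 2).
  by rewrite ler_norml; move: ht; clear; lra.
exists i => //; have := hc _ Pi _ s01; move: h; rewrite !ler_norml; clear; lra.
Qed.

Lemma sum_lengths (D : set nat) (gamma : nat -> R -> R * R) (K : nat) :
  (forall i, D i -> rectifiable_curve (gamma i)) ->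
  ((\sum_(i < K | `[< D i >]) fine (curve_length (gamma i)))%:E <= total_length D gamma)%E.
Proof.
move=> rect; rewrite /total_length esum_mkcond; apply: esum_ge.
exists `I_K; first by split=> //; exact: finite_II.
rewrite -fsbig_ord (eq_bigr (fun i : 'I_K =>
    (if `[< D i >] then fine (curve_length (gamma i)) else 0)%:E)) => [|i _].
  by rewrite sumEFin -big_mkcond.
have -> : (nat_of_ord i \in D) = `[< D i >] by apply/idP/asboolP => [/set_mem|/mem_set].
by case: asboolP => // Di; rewrite fineK// (curve_length_fin (rect _ Di)).
Qed.
End Barrier.

(** * Boxes of finitely many curves as one family *)

Section Assembly.
Variable R : realType.
Local Open Scope classical_set_scope.
(** A line within [r i] of a curve point hits the box of that point once both half-sides grow by
    [r i]. *)
Lemma tagged_cover (D : set nat) (n : nat -> nat) (x y : nat -> R -> R)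
    (cx cy w h : nat -> nat -> R) (r : nat -> R) (K : nat) :
  (forall i s, D i -> 0 <= s <= 1 -> exists k : 'I_(n i),
    `|x i s - cx i k| <= w i k /\ `|y i s - cy i k| <= h i k) ->
  (forall u t, `|u| <= 1 -> `|t| <= 1 -> exists i s,
    [/\ (i < K)%N, D i, 0 <= s <= 1 &
     `|x i s + u * y i s - t * (1 + `|u|)| < r i * (1 + `|u|)]) ->
  @steep_cover R {i : 'I_K & 'I_(n i)}
    (fun j => cx (tag j) (tagged j)) (fun j => cy (tag j) (tagged j))
    (fun j => w (tag j) (tagged j) + r (tag j)) (fun j => h (tag j) (tagged j) + r (tag j)).
Proof.
move=> boxed block u t u1 t1; have [i [s [iK Di s01 lt_r]]] := block u t u1 t1.
have [k [hx hy]] := boxed i s Di s01.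
exists (@Tagged 'I_K (Ordinal iK) (fun i : 'I_K => 'I_(n i)) k) => /=.
have -> : cx i k + u * cy i k - t * (1 + `|u|) =
    (x i s + u * y i s - t * (1 + `|u|)) - (x i s - cx i k) - u * (y i s - cy i k) by ring.
apply: le_trans (ler_normB _ _) _.
have := ler_normB (x i s + u * y i s - t * (1 + `|u|)) (x i s - cx i k).
have : `|u * (y i s - cy i k)| <= `|u| * h i k by rewrite normrM ler_wpM2l.
by lra.
Qed.

Lemma sum_tagged (K : nat) (n : nat -> nat) (F : nat -> nat -> R) :
  \sum_(j : {i : 'I_K & 'I_(n i)}) F (tag j) (tagged j) = \sum_(i < K) \sum_(k < n i) F i k.
Proof. by rewrite sig_big_dep. Qed.

Lemma sum_geometric (K : nat) (e : R) : 0 <= e -> \sum_(i < K) e / 2 ^+ i.+1 <= e.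
Proof.
move=> e0; suff -> : \sum_(i < K) e / 2 ^+ i.+1 = e - e / 2 ^+ K.
  by rewrite gerBl divr_ge0// exprn_ge0.
elim: K => [|K IH]; first by rewrite big_ord0 expr0 divr1 subrr.
rewrite big_ord_recr /= IH exprS invfM; field.
by rewrite expf_neq0.
Qed.

(** Dyadic weights split among the boxes of each curve keep the enlargements small in total, both
    over curves and over boxes; [.+1] covers curves without boxes. *)
Lemma sum_split_half (K : nat) (n : nat -> nat) (e : R) : 0 <= e ->
  let r i := e / 2 ^+ i.+1 / (n i).+1%:R in
  [/\ forall i, 0 <= r i <= e, \sum_(i < K) r i <= e & \sum_(i < K) \sum_(k < n i) r i <= e].
Proof.
move=> e0 r.
have q0 i : 0 <= e / 2 ^+ i.+1 by rewrite divr_ge0// exprn_ge0.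
have n0 i : 0 < (n i).+1%:R :> R by rewrite ltr0n.
have r0 i : 0 <= r i by rewrite divr_ge0// ltW.
have rq i : (n i).+1%:R * r i = e / 2 ^+ i.+1 by rewrite mulrC divfK// gt_eqF.
have r1 i : r i <= e / 2 ^+ i.+1.
  by rewrite -rq -{1}[r i]mul1r ler_wpM2r// ler1n.
have qe i : e / 2 ^+ i.+1 <= e.
  by rewrite ler_pdivrMr ?exprn_gt0// ler_peMr// exprn_ege1// ler1n.
split=> [i||].
- by rewrite r0 (le_trans (r1 i)).
- by apply: le_trans (sum_geometric K e0); apply: ler_sum => i _.
apply: le_trans (sum_geometric K e0); apply: ler_sum => i _.
by rewrite sumr_const card_ord -[leLHS]mulr_natl -[leRHS](rq i) ler_wpM2r// ler_nat.
Qed.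
End Assembly.

Section Diagonals.
Variable R : realType.
Local Open Scope classical_set_scope.
(** On one curve the diagonal coordinate oscillates by at most its total variation, which bounds the
    shadow of the curve. *)
Lemma diagonal_sum (D : set nat) (gamma : nat -> R -> R * R) (r : nat -> R) (K : nat) (z : R) :
  (forall i, D i -> rectifiable_curve (gamma i)) -> (forall i, 0 <= r i) -> `|z| = 1 ->
  (forall u t, `|u| <= 1 -> `|t| <= 1 -> exists i s, [/\ (i < K)%N, D i, 0 <= s <= 1 &
     `|(2 * (gamma i s).1 - 1) + u * (2 * (gamma i s).2 - 1) - t * (1 + `|u|)| <
     r i * (1 + `|u|)]) ->
  2 <= \sum_(i < K | `[< D i >]) rtv 0 1 (fun s => (gamma i s).1 + z * (gamma i s).2) +
    2 * \sum_(i < K) r i.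
Proof.
move=> rect r0 z1 block.
have le_sum : \sum_(i < K | `[< D i >]) r i <= \sum_(i < K) r i.
  by rewrite [leRHS](bigID (fun i : 'I_K => `[< D i >])) /= lerDl sumr_ge0.
suff : 2 <= \sum_(i < K | `[< D i >]) rtv 0 1 (fun s => (gamma i s).1 + z * (gamma i s).2) +
    2 * \sum_(i < K | `[< D i >]) r i.
  move: (\sum_(i < K | `[< D i >]) rtv _ _ _) (\sum_(i < K) r i) le_sum.
  move: (\sum_(i < K | `[< D i >]) r i).
  by move=> ? ? ? ?; lra.
apply: (@shadow_sum _ _ _ (fun i s => (gamma i s).1 + z * (gamma i s).2) (1 + z)).
- by move=> i; exact: rtv_ge0.
- by move=> i; exact: r0.
- move=> i /asboolP Di; have hg := rect i Di.
  have [cx cy] := curve_continuous hg.1; have [_ _ fp fm] := TV_curve_fin hg.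
  have [cz fz] : {within `[0, 1], continuous (fun s => (gamma i s).1 + z * (gamma i s).2)} /\
      TV 0 1 (fun s => (gamma i s).1 + z * (gamma i s).2) \is a fin_num.
    split.
      by move=> s; apply: cvgD; [exact: cx|apply: cvgM; [exact: cvg_cst|exact: cy]].
    have [z0|z0] := leP 0 z.
      by move: z1; rewrite ger0_norm// => ->; under eq_fun do rewrite mul1r.
    have -> : z = -1 by rewrite -z1 ltr0_norm// opprK.
    by under eq_fun do rewrite mulN1r.
  have [//|s [t [s01 t01 h]]] := extremes _ cz.
  eexists => w w01; apply: le_trans (h w w01) _.
  exact: (dist_le_rtv fz s01 t01).
move=> t t1; have [||i [s [iK Di s01 h]]] := block z t; rewrite ?z1//.
exists (Ordinal iK), s; split=> //=; first exact/asboolP.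
rewrite [X in `|X|](_ : _ = 2 * (gamma i s).1 - 1 + z * (2 * (gamma i s).2 - 1) - t * (1 + `|z|)).
  by rewrite [leRHS]mulrC (le_trans (ltW h))// z1.
by rewrite z1; ring.
Qed.
End Diagonals.

Theorem theorem2 (R : realType) (D : set nat) (gamma : nat -> R -> R * R)
    (hrect : rectifiable_family D gamma)
    (hbar : interior_barrier (unit_square R) (curves_union D gamma)) :
  ((2 + 10 ^- 5)%:E <= total_length D gamma)%E.
Proof.
have [rect _] := hrect; rewrite leNgt; apply/negP => short.
have gU i s : D i -> 0 <= s <= 1 -> 0 <= (gamma i s).1 <= 1 /\ 0 <= (gamma i s).2 <= 1.
  move=> Di s01; have [|] := hbar.2 (gamma i s).
    by exists i => //; exists s => //=; rewrite in_itv.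
  by rewrite /= !in_itv.
(* Indices outside [D] get no boxes, so box sums may run over all [i < K]. *)
have /choice[b hb] i : exists b,
    (D i -> boxes_of (gamma i) (1 / 2000) b) /\ (~ D i -> bnum b = 0%N).
  have [Di|nDi] := pselect (D i).
    have [|b hb] := curve_boxes (rect i Di) (_ : 0 < 1 / 2000) (fun s => gU i s Di); first by lra.
    by exists b.
  by exists (Boxes 0 (fun=> 0) (fun=> 0) (fun=> 0) (fun=> 0)).
pose e : R := 1 / (1000 * 1000 * 10).
have e_gt0 : 0 < e by rewrite /e; lra.
have e0 := ltW e_gt0.
pose r i := e / 2 ^+ i.+1 / (bnum (b i)).+1%:R.
have r0 i : 0 < r i by rewrite /r; apply: divr_gt0 => //; apply: divr_gt0 => //; exact: exprn_gt0.
have block1 u t : `|u| <= 1 -> `|t| <= 1 -> exists i s, [/\ D i, 0 <= s <= 1 &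
    (2 * (gamma i s).1 - 1) + u * (2 * (gamma i s).2 - 1) = t * (1 + `|u|)].
  move=> _ t1; have [|i [s [Di s01 h]]] := scaled_line_blocked hbar (a := 1) (b := u) _ t1.
    by rewrite xpair_eqE oner_eq0.
  by exists i, s; split=> //; rewrite -[X in X + _]mul1r h normr1.
have block2 u t : `|u| <= 1 -> `|t| <= 1 -> exists i s, [/\ D i, 0 <= s <= 1 &
    (2 * (gamma i s).2 - 1) + u * (2 * (gamma i s).1 - 1) = t * (1 + `|u|)].
  move=> _ t1; have [|i [s [Di s01 h]]] := scaled_line_blocked hbar (a := u) (b := 1) _ t1.
    by rewrite xpair_eqE oner_eq0 andbF.
  by exists i, s; split=> //; rewrite addrC -[X in _ + X]mul1r h normr1 [in RHS]addrC.
have [K1 cov1] := finite_blockers r0 block1; have [K2 cov2] := finite_blockers r0 block2.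
pose K := maxn K1 K2.
have [re rK rbK] := sum_split_half K (fun i => bnum (b i)) e0.
have {}cov1 u t : `|u| <= 1 -> `|t| <= 1 -> exists i s, [/\ (i < K)%N, D i, 0 <= s <= 1 &
    `|(2 * (gamma i s).1 - 1) + u * (2 * (gamma i s).2 - 1) - t * (1 + `|u|)| < r i * (1 + `|u|)].
  move=> u1 t1; have [i [s [iK Di s01 h]]] := cov1 u t u1 t1.
  by exists i, s; split=> //; apply: leq_trans iK (leq_maxl _ _).
have {}cov2 u t : `|u| <= 1 -> `|t| <= 1 -> exists i s, [/\ (i < K)%N, D i, 0 <= s <= 1 &
    `|(2 * (gamma i s).2 - 1) + u * (2 * (gamma i s).1 - 1) - t * (1 + `|u|)| < r i * (1 + `|u|)].
  move=> u1 t1; have [i [s [iK Di s01 h]]] := cov2 u t u1 t1.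
  by exists i, s; split=> //; apply: leq_trans iK (leq_maxr _ _).
have inb i k (ki : (k < bnum (b i))%N) : D i.
  by have [_ h] := hb i; apply: contrapT => /h b0; rewrite b0 in ki.
have bb i (k : 'I_(bnum (b i))) : [/\ `|bX (b i) k| <= 1, `|bY (b i) k| <= 1,
    0 <= bW (b i) k <= 1 / 2000 & 0 <= bH (b i) k <= 1 / 2000].
  by have [/(_ (inb i k (ltn_ord k)))[h _ _] _] := hb i; exact: h.
(* Half-sides [1/2000] enlarged by at most [1/2000] meet the bound [1/1000] of [no_small_boxes]. *)
have rr i : 0 <= r i <= 1 / 2000.
  by have := re i; rewrite -/(r i) /e; move: (r i) => a; clear; lra.
apply: (@no_small_boxes R {i : 'I_K & 'I_(bnum (b i))} (fun j => bX (b (tag j)) (tagged j))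
  (fun j => bY (b (tag j)) (tagged j)) (fun j => bW (b (tag j)) (tagged j) + r (tag j))
  (fun j => bH (b (tag j)) (tagged j) + r (tag j)) (4 / 625)) => //.
- move=> [i k] /=; have [_ _ h _] := bb i k; have := rr i; move: h; clear; lra.
- move=> [i k] /=; have [_ _ _ h] := bb i k; have := rr i; move: h; clear; lra.
- by move=> [i k] /=; have [] := bb i k.
- by move=> [i k] /=; have [] := bb i k.
- apply: (@tagged_cover R D (fun i => bnum (b i)) _ _ (fun i => bX (b i)) (fun i => bY (b i))
    (fun i => bW (b i)) (fun i => bH (b i)) r K _ cov1).
  by move=> i s Di s01; have [/(_ Di)[_ h _] _] := hb i; exact: h.
- apply: (@tagged_cover R D (fun i => bnum (b i)) _ _ (fun i => bY (b i)) (fun i => bX (b i))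
    (fun i => bH (b i)) (fun i => bW (b i)) r K _ cov2).
  by move=> i s Di s01; have [/(_ Di)[_ h _] _] := hb i; have [k [h1 h2]] := h s s01; exists k.
rewrite (@sum_tagged R K (fun i => bnum (b i)) (fun i k => bW (b i) k + r i + (bH (b i) k + r i))).
pose SB := \sum_(i < K) \sum_(k < bnum (b i)) (bW (b i) k + bH (b i) k).
pose SL := \sum_(i < K | `[< D i >]) fine (curve_length (gamma i)).
pose SV (f : nat -> R -> R) := \sum_(i < K | `[< D i >]) rtv 0 1 (f i).
pose diag z i s := (gamma i s).1 + z * (gamma i s).2.
have hSL : SL <= 2 + 10 ^- 5.
  by have := le_lt_trans (sum_lengths K rect) short; rewrite lte_fin => /ltW.
have hp : 2 <= SV (diag 1) + 2 * e.
  apply: le_trans (diagonal_sum rect (fun i => ltW (r0 i)) (normr1 _) cov1) _.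
  by rewrite lerD2l ler_pM2l.
have hm : 2 <= SV (diag (-1)) + 2 * e.
  apply: le_trans (diagonal_sum rect (fun i => ltW (r0 i)) (normrN1 _) cov1) _.
  by rewrite lerD2l ler_pM2l.
have hL : SV (fun i s => (gamma i s).1) + SV (fun i s => (gamma i s).2) +
    299 / 2 * (SV (diag 1) + SV (diag (-1))) <= (300 + 1 / 600) * SL.
  rewrite -!big_split/= mulr_sumr -big_split/= mulr_sumr; apply: ler_sum => i /asboolP Di.
  apply: le_trans (rtv_length (rect i Di)); rewrite lerD2l ler_pM2l; last by lra.
  have -> : diag 1 i = fun s => (gamma i s).1 + (gamma i s).2.
    by apply/funext => s; rewrite /diag mul1r.
  have -> : diag (-1) i = fun s => (gamma i s).1 - (gamma i s).2.
    by apply/funext => s; rewrite /diag mulN1r.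
  by [].
have hSB : SB <= SV (fun i s => (gamma i s).1) + SV (fun i s => (gamma i s).2).
  rewrite -big_split/= /SB [leRHS]big_mkcond; apply: ler_sum => i _.
  case: asboolP => [Di|nDi]; first by have [/(_ Di)[]] := hb i.
  by rewrite big1// => k; case: nDi; exact: inb (ltn_ord k).
have -> : \sum_(i < K) \sum_(k < bnum (b i)) (bW (b i) k + r i + (bH (b i) k + r i)) =
    SB + 2 * \sum_(i < K) \sum_(k < bnum (b i)) r i.
  rewrite mulr_sumr -big_split/=; apply: eq_bigr => i _.
  by rewrite mulr_sumr -big_split/=; apply: eq_bigr => k _; ring.
have eps : 10 ^- 5 = 1 / (10 * 10 * 10 * 10 * 10) :> R by rewrite !exprS expr0 mulr1 !mulrA div1r.
(* [(300 + 1/600) (2 + 10^-5) - 299/2 (4 - 4 e) + 2 e] is about [2.00639], just below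
   [2 + 4/625]. *)
move: rbK hSL hp hm hL hSB; rewrite -/r eps /e.
move: (\sum_(i < K) _) SL (SV (diag 1)) (SV (diag (-1))) SB (SV _) (SV _).
clear => *; lra.
Qed.
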